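(* Let $\mathcal{A}$ be a locally finitely presented additive category and let $M$ be an object of $\mathcal{A}$ such that for every finitely presented object $X$ of $\mathcal{A}$ the cardinal of $\mathrm{Hom}(X,M)$ is not $\omega$-measurable. The following are equivalent: (i) $\mathrm{Add}(M)\subseteq \mathrm{Prod}(M)$; (ii) $M$ is $\Sigma$-pure-injective.
   Context: An object $X$ of an additive category with filtered colimits is finitely presented if $\mathrm{Hom}(X,-)$ commutes with filtered colimits. A locally finitely presented category is a cocomplete additive category $\mathcal{A}$ whose finitely presented objects form an essentially small full subcategory $\mathrm{fp}\,\mathcal{A}$ and in which every object is a filtered colimit of finitely presented objects; such a category is idempotent complete and has cokernels, filtered colimits, direct sums and direct products. For an object $M$, $\mathrm{Add}(M)$ (resp. $\mathrm{Prod}(M)$) is the class of all direct summands of direct sums (resp. direct products) of copies of $M$. A sequence $0\to K\xrightarrow{\alpha} L\xrightarrow{\beta} N\to 0$ in $\mathcal{A}$ is pure-exact if $0\to \mathrm{Hom}(X,K)\to\mathrm{Hom}(X,L)\to\mathrm{Hom}(X,N)\to 0$ is exact for every $X\in\mathrm{fp}\,\mathcal{A}$; then $\alpha$ is called a pure monomorphism and $\beta$ a pure epimorphism. An object $N$ is pure-injective if $\mathrm{Hom}(\alpha,N)$ is surjective for every pure monomorphism $\alpha$. An object $M$ is $\Sigma$-pure-injective if $M^{(J)}$ (the direct sum of copies of $M$ indexed by $J$) is pure-injective for every set $J$. A cardinal $\kappa=|I|$ is $\omega$-measurable if it is uncountable and there is a countably additive $\{0,1\}$-valued measure $\mu$ defined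 on all subsets of $I$ with $\mu(I)=1$ and $\mu(\{x\})=0$ for all $x\in I$. *)

(* Defs.v *)
From HB Require Import structures.
From mathcomp Require Import all_boot all_order all_algebra.
From mathcomp Require Import boolp classical_sets functions cardinality.
From mathcomp Require Import reals ereal measure.

Set Implicit Arguments.
Unset Strict Implicit.
Unset Printing Implicit Defensive.

Import GRing.Theory.

Local Open Scope classical_set_scope.
Local Open Scope ring_scope.

(* "Sets" are the inhabitants of one fixed universe, the universe of the       *)
(* carriers of zmodTypes: hom-sets, index sets and index categories all live   *)
(* in it, whereas the objects of a category may form a type in a larger        *)
(* universe.                                                                   *)
Definition smallType :=
  ltac:(match type of GRing.Zmodule.sort with _ -> ?T => exact T end).

Record category_on (Ob : Type) := CategoryOn {
  hom_on : Ob -> Ob -> smallType;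
  id_on : forall X, hom_on X X;
  comp_on : forall X Y Z, hom_on Y Z -> hom_on X Y -> hom_on X Z;
  comp1m_on : forall X Y (f : hom_on X Y), comp_on (id_on Y) f = f;
  compm1_on : forall X Y (f : hom_on X Y), comp_on f (id_on X) = f;
  compA_on : forall X Y Z W (h : hom_on Z W) (g : hom_on Y Z) (f : hom_on X Y),
    comp_on h (comp_on g f) = comp_on (comp_on h g) f
}.

Record category := Category {
  Ob :> Type;
  category_class : category_on Ob
}.

(* The underlying category has its objects in smallType only.                  *)
Record small_category := SmallCategory {
  small_Ob : smallType;
  small_class : category_on small_Ob
}.

Coercion category_of_small (J : small_category) : category :=
  Category (small_class J).

Definition hom (C : category) (X Y : C) : smallType :=
  hom_on (category_class C) X Y.

Definition idm (C : category) (X : C) : hom X X := id_on (category_class C) X.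

Definition comp (C : category) (X Y Z : C) (g : hom Y Z) (f : hom X Y) :
  hom X Z := comp_on g f.

Notation "g '∘' f" := (comp g f) (at level 40, left associativity).

Lemma comp1m (C : category) (X Y : C) (f : hom X Y) : idm Y ∘ f = f.
Proof. exact: comp1m_on. Qed.

Lemma compm1 (C : category) (X Y : C) (f : hom X Y) : f ∘ idm X = f.
Proof. exact: compm1_on. Qed.

Lemma compA (C : category) (X Y Z W : C)
  (h : hom Z W) (g : hom Y Z) (f : hom X Y) : h ∘ (g ∘ f) = h ∘ g ∘ f.
Proof. exact: compA_on. Qed.

Definition is_iso (C : category) (X Y : C) (f : hom X Y) :=
  exists g : hom Y X, g ∘ f = idm X /\ f ∘ g = idm Y.

Definition isomorphic (C : category) (X Y : C) :=
  exists f : hom X Y, is_iso f.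

Definition is_initial (C : category) (Z : C) :=
  forall X : C, exists! f : hom Z X, True.

Definition is_terminal (C : category) (Z : C) :=
  forall X : C, exists! f : hom X Z, True.

Definition is_product (C : category) (J : smallType) (F : J -> C)
    (P : C) (p : forall j, hom P (F j)) :=
  forall (Y : C) (f : forall j, hom Y (F j)),
    exists! h : hom Y P, forall j, p j ∘ h = f j.

Definition is_coproduct (C : category) (J : smallType) (F : J -> C)
    (S : C) (i : forall j, hom (F j) S) :=
  forall (Y : C) (f : forall j, hom (F j) Y),
    exists! h : hom S Y, forall j, h ∘ i j = f j.

Record functor (C D : category) := Functor {
  fobj :> C -> D;
  fmap : forall X Y : C, hom X Y -> hom (fobj X) (fobj Y);
  fmap1 : forall X : C, fmap (idm X) = idm (fobj X);
  fmap_comp : forall (X Y Z : C) (g : hom Y Z) (f : hom X Y),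
    fmap (g ∘ f) = fmap g ∘ fmap f
}.

Program Definition functor_comp (C D E : category) (G : functor D E)
  (F : functor C D) : functor C E :=
  {| fobj := fun X => G (F X); fmap := fun X Y f => fmap G (fmap F f) |}.
Next Obligation. by move=> C D E G F X /=; rewrite !fmap1. Qed.
Next Obligation. by move=> C D E G F X Y Z g f /=; rewrite !fmap_comp. Qed.

Definition is_cocone (J C : category) (F : functor J C) (L : C)
    (c : forall j, hom (F j) L) :=
  forall (j k : J) (u : hom j k), c k ∘ fmap F u = c j.

Definition is_colimit (J C : category) (F : functor J C) (L : C)
    (c : forall j, hom (F j) L) :=
  is_cocone c /\
  forall (L' : C) (c' : forall j, hom (F j) L'), is_cocone c' ->
    exists! h : hom L L', forall j, h ∘ c j = c' j.

Definition cocomplete (C : category) :=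
  forall (J : small_category) (F : functor J C),
    exists (L : C) (c : forall j, hom (F j) L), is_colimit c.

Definition is_filtered (J : category) :=
  [/\ inhabited J,
      forall j k : J, exists l : J, inhabited (hom j l) /\ inhabited (hom k l)
    & forall (j k : J) (u v : hom j k),
        exists (l : J) (w : hom k l), w ∘ u = w ∘ v].

Definition preserves_filtered_colimits (C D : category) (T : functor C D) :=
  forall (J : small_category), is_filtered J ->
  forall (F : functor J C) (L : C) (c : forall j, hom (F j) L),
    is_colimit c ->
    @is_colimit J D (functor_comp T F) (T L) (fun j => fmap T (c j)).

Record preadditive_category := PreadditiveCategory {
  pa_category :> category;
  hom_zmod : forall X Y : pa_category, GRing.Zmodule (hom X Y);
  compDl_zmod : forall (X Y Z : pa_category) (g g' : hom Y Z) (f : hom X Y),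
    @GRing.add (GRing.Zmodule.Pack (hom_zmod Y Z)) g g' ∘ f =
    @GRing.add (GRing.Zmodule.Pack (hom_zmod X Z)) (g ∘ f) (g' ∘ f);
  compDr_zmod : forall (X Y Z : pa_category) (g : hom Y Z) (f f' : hom X Y),
    g ∘ @GRing.add (GRing.Zmodule.Pack (hom_zmod X Y)) f f' =
    @GRing.add (GRing.Zmodule.Pack (hom_zmod X Z)) (g ∘ f) (g ∘ f')
}.

HB.instance Definition _ (A : preadditive_category) (X Y : A) :=
  GRing.Zmodule.copy (hom X Y) (GRing.Zmodule.Pack (hom_zmod X Y)).

Lemma compDl (A : preadditive_category) (X Y Z : A)
  (g g' : hom Y Z) (f : hom X Y) : (g + g') ∘ f = g ∘ f + g' ∘ f.
Proof. exact: compDl_zmod. Qed.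

Lemma compDr (A : preadditive_category) (X Y Z : A)
  (g : hom Y Z) (f f' : hom X Y) : g ∘ (f + f') = g ∘ f + g ∘ f'.
Proof. exact: compDr_zmod. Qed.

Lemma additive_ext (U V : zmodType) (f g : {additive U -> V}) :
  f =1 g -> f = g.
Proof.
case: f g => [f [[Hf]]] [g [[Hg]]] /= /funext fg; subst g.
by rewrite (Prop_irrelevance Hf Hg).
Qed.

Program Definition Ab_class : category_on zmodType :=
  {| hom_on := fun U V : zmodType => {additive U -> V};
     id_on := fun U => idfun : {additive U -> U};
     comp_on := fun U V W g f => (g \o f)%FUN : {additive U -> W} |}.
Next Obligation. by move=> U V f; apply: additive_ext. Qed.
Next Obligation. by move=> U V f; apply: additive_ext. Qed.
Next Obligation. by move=> U V W Z h g f; apply: additive_ext. Qed.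

Definition Ab : category := Category Ab_class.

Section LeftComposition.
Variables (A : preadditive_category) (X Y Z : A) (g : hom Y Z).

Definition lcomp (f : hom X Y) : hom X Z := g ∘ f.

Lemma lcomp_is_zmod_morphism : zmod_morphism lcomp.
Proof.
move=> f f'; rewrite /lcomp; apply: (addIr (g ∘ f')).
by rewrite -compDr !subrK.
Qed.

HB.instance Definition _ :=
  GRing.isZmodMorphism.Build (hom X Y) (hom X Z) lcomp lcomp_is_zmod_morphism.

End LeftComposition.

Program Definition Hom_functor (A : preadditive_category) (X : A) :
    functor A Ab :=
  {| fobj := fun Y => hom X Y : zmodType;
     fmap := fun Y Z g => @lcomp A X Y Z g : {additive hom X Y -> hom X Z} |}.
Next Obligation.
by move=> A X Y; apply: additive_ext => f; exact: comp1m.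
Qed.
Next Obligation.
by move=> A X Y Z W g f; apply: additive_ext => h; symmetry; exact: compA.
Qed.

Definition is_biproduct (A : preadditive_category) (X Y S : A)
    (i1 : hom X S) (i2 : hom Y S) (p1 : hom S X) (p2 : hom S Y) :=
  [/\ p1 ∘ i1 = idm X, p2 ∘ i2 = idm Y & i1 ∘ p1 + i2 ∘ p2 = idm S].

Definition is_additive (A : preadditive_category) :=
  (exists Z : A, is_initial Z /\ is_terminal Z) /\
  (forall X Y : A, exists (S : A) (i1 : hom X S) (i2 : hom Y S)
    (p1 : hom S X) (p2 : hom S Y), is_biproduct i1 i2 p1 p2).

Definition finitely_presented (A : preadditive_category) (X : A) :=
  preserves_filtered_colimits (Hom_functor X).

Definition fp_essentially_small (A : preadditive_category) :=
  exists (J : smallType) (G : J -> A),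
    (forall j, finitely_presented (G j)) /\
    (forall X : A, finitely_presented X -> exists j, isomorphic X (G j)).

Definition locally_finitely_presented (A : preadditive_category) :=
  [/\ is_additive A,
      cocomplete A,
      fp_essentially_small A
    & forall X : A, exists (J : small_category) (F : functor J A)
        (c : forall j, hom (F j) X),
        [/\ is_filtered J, forall j, finitely_presented (F j)
          & is_colimit c]].

Definition direct_summand (A : preadditive_category) (N S : A) :=
  exists (N' : A) (i1 : hom N S) (i2 : hom N' S) (p1 : hom S N) (p2 : hom S N'),
    is_biproduct i1 i2 p1 p2.

Definition Add (A : preadditive_category) (M N : A) :=
  exists (J : smallType) (S : A) (i : J -> hom M S),
    @is_coproduct A J (fun=> M) S i /\ direct_summand N S.

Definition Prod (A : preadditive_category) (M N : A) :=
  exists (J : smallType) (P : A) (p : J -> hom P M),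
    @is_product A J (fun=> M) P p /\ direct_summand N P.

Definition short_exact (U V W : zmodType)
    (f : {additive U -> V}) (g : {additive V -> W}) :=
  [/\ injective f, range f = [set v | g v = 0] & range g = [set: W]].

Definition pure_exact (A : preadditive_category) (K L N : A)
    (a : hom K L) (b : hom L N) :=
  forall X : A, finitely_presented X ->
    short_exact (fmap (Hom_functor X) a) (fmap (Hom_functor X) b).

Definition pure_mono (A : preadditive_category) (K L : A) (a : hom K L) :=
  exists (N : A) (b : hom L N), pure_exact a b.

Definition pure_injective (A : preadditive_category) (N : A) :=
  forall (K L : A) (a : hom K L), pure_mono a ->
    forall f : hom K N, exists g : hom L N, g ∘ a = f.

(* The coproduct is quantified universally rather than chosen: it is unique up *)
(* to isomorphism, and it exists when A is cocomplete.                         *)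
Definition Sigma_pure_injective (A : preadditive_category) (M : A) :=
  forall (J : smallType) (S : A) (i : J -> hom M S),
    @is_coproduct A J (fun=> M) S i -> pure_injective S.

(* omega_measurable T says that the cardinal of T is omega-measurable.  The    *)
(* witness I is allowed to be any set with that cardinal because the library's *)
(* measurable types carry a base point, which T need not have.                 *)
Definition omega_measurable (T : Type) :=
  ~ countable [set: T] /\
  exists (d : measure_display) (I : measurableType d) (R : realType)
    (mu : {measure set I -> \bar R}),
    [/\ ([set: T] #= [set: I])%card,
        forall B : set I, measurable B,
        forall B : set I, mu B = 0%E \/ mu B = 1%E,
        mu [set: I] = 1%E
      & forall x : I, mu [set x] = 0%E].

(* Main.v *)
From HB Require Import structures.
From mathcomp Require Import all_boot all_order all_algebra.
From mathcomp Require Import boolp classical_sets functions cardinality.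
From mathcomp Require Import reals ereal measure topology normedtype sequences.
From mathcomp Require Import Rstruct.
Require Import Defs.

(* (ii) => (i): M^(J) -> M^J is a pure monomorphism, because its cokernel is   *)
(* the filtered colimit of M^J along the operators erasing finitely many       *)
(* coordinates; when M^(J) is pure-injective it splits.                        *)
(*                                                                             *)
(* (i) => (ii): for X finitely presented, a chain of morphisms                 *)
(* w_(n+1) = t_n w_n out of X cuts out a descending chain U_n of definable     *)
(* subgroups of H = Hom(X, M).  If M^(J) is a summand of M^I, the projection   *)
(* gives a map H^I -> H^(J) preserving the U_n.  Chase's argument shows that   *)
(* the subsets A of I for which the image of U_n^A is eventually contained,    *)
(* modulo the intersection of the U_m, in finitely many coordinates form a     *)
(* countably complete ideal.  On an atom of this ideal the non-measurability   *)
(* of |H| makes every map I -> H constant up to the ideal, so that altogether  *)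
(* the image of U_n^I only reaches |H| + aleph_0 coordinates for n large.  If  *)
(* |J| is larger than that, the chain U_n is stationary.  The resulting        *)
(* descending chain condition passes to M^(J), and a Zorn argument on partial  *)
(* maps preserving definable conditions extends morphisms along pure           *)
(* monomorphisms.                                                              *)

Set Implicit Arguments.
Unset Strict Implicit.
Unset Printing Implicit Defensive.

Import GRing.Theory.

Local Open Scope classical_set_scope.
Local Open Scope ring_scope.

(** * Chase's lemma for non-measurable groups *)

(** The hinge is the descending chain condition [definable_dcc] on the subgroups of Hom(X, M) formed
    by the maps that factor through a given [w] out of X. Condition (i) yields it for M, it passes
    to every M^(J), and it makes an object pure-injective.

    If M^(J) is a summand of M^I and H = Hom(X, M), the projection induces an additive map from H^I
    to H^(J) respecting the definable subgroups. By [chase_nonmeasurable] some U_n^I then lands in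
    the intersection of all U_m outside at most |H| + aleph_0 coordinates. With J a large power set,
    an element of U_n outside U_(n+1) placed at a remaining coordinate is recovered by the
    splitting, a contradiction ([Add_Prod_definable_dcc]). Finite supports transfer the condition to
    M^(J) ([definable_dcc_coproduct]), and [pure_extension] extends morphisms by enlarging a partial
    map one finitely presented point at a time.

    Conversely M^(J) is pure in M^J ([pure_coproduct_product]), hence a summand of it once
    pure-injective. *)

Section Small.
Variables (H J : Type) (h0 : H) (j0 : J).

(** For nonempty [H] this means cardinality at most |H| + aleph_0, phrased as a covering to avoid
    cardinal arithmetic. *)
Definition small (F : set J) := exists f : nat * H -> J, F `<=` range f.

Lemma finite_set_range (F : set J) :
  finite_set F -> exists f : nat -> J, F `<=` range f.
Proof.
move=> /finite_set_countable/countable_injP[e e_inj].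
have [f fP] : {f : nat -> J & forall n, forall j, F j -> e j = n -> f n = j}.
  apply: (@choice nat J (fun n i => forall j, F j -> e j = n -> i = j)) => n.
  have [[i [Fi ein]]|nF] := pselect (exists i, F i /\ e i = n).
    by exists i => j Fj ejn; apply: e_inj; rewrite ?inE // ein.
  by exists j0 => j Fj ejn; case: nF; exists j.
by exists f => j Fj; exists (e j) => //; exact: fP.
Qed.

Lemma finite_small (F : set J) : finite_set F -> small F.
Proof.
move=> /finite_set_range[f Ff]; exists (fun p => f p.1) => j /Ff[n _ <-].
by exists (n, h0).
Qed.

Lemma small_bigcup (D : H -> set J) :
  (forall h, finite_set (D h)) -> small (\bigcup_h D h).
Proof.
move=> Dfin.
have [f fP] : {f : H -> nat -> J & forall h, D h `<=` range (f h)}.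
  by apply: (@choice H (nat -> J) (fun h g => D h `<=` range g)) => h; exact: finite_set_range.
exists (fun p => f p.2 p.1) => j [h _ /fP[n _ <-]].
by exists (n, h).
Qed.

Lemma smallU F G : small F -> small G -> small (F `|` G).
Proof.
move=> [f Ff] [g Gg].
exists (fun p => if odd p.1 then f (p.1./2, p.2) else g (p.1./2, p.2)).
move=> j [/Ff[[n h] _ <-]|/Gg[[n h] _ <-]].
  by exists (n.*2.+1, h) => //=; rewrite odd_double /= uphalf_double.
by exists (n.*2, h) => //=; rewrite odd_double doubleK.
Qed.

End Small.

(** * Countably complete ultrafilters as two-valued measures *)

Section DiscreteSpace.
Variables (T : Type) (t0 : T).

Definition discrete_space of T : Type := T.

HB.instance Definition _ := gen_eqMixin (discrete_space t0).
HB.instance Definition _ := gen_choiceMixin (discrete_space t0).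
HB.instance Definition _ := isPointed.Build (discrete_space t0) t0.
HB.instance Definition _ := @isMeasurable.Build default_measure_display
  (discrete_space t0) discrete_measurable discrete_measurable0
  discrete_measurableC discrete_measurableU.

End DiscreteSpace.

(* [N] is the ideal of null sets of a countably complete ultrafilter.          *)
Lemma sigma_ultrafilter_principal (T : Type) (N : set (set T)) :
  ~ omega_measurable T -> ~ N setT ->
  (forall A B, A `<=` B -> N B -> N A) -> (forall A, N A \/ N (~` A)) ->
  (forall F : nat -> set T, (forall k, N (F k)) -> N (\bigcup_k F k)) ->
  exists t, ~ N [set t].
Proof.
move=> nT NT NS NC Nbig; apply: contrapT => Nt.
have {}Nt t : N [set t] by apply: contrapT => ?; apply: Nt; exists t.
have N0 : N set0 by have [/NS|/NS] := NC set0; apply.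
apply: nT; split.
  move=> /countable_injP[f f_inj]; apply: NT.
  rewrite (_ : setT = \bigcup_n f @^-1` [set n]); last first.
    by apply/seteqP; split=> // t _; exists (f t).
  apply: Nbig => n; have [[t ft]|nf] := pselect (exists t, f t = n).
    apply: NS (Nt t) => u /= fu; apply: f_inj; rewrite ?inE //.
    by rewrite ft fu.
  by apply: NS N0 => t ft; apply: nf; exists t.
have [[t0]|T0] := pselect (inhabited T); last first.
  by case: NT; apply: NS N0 => t _; case: (T0 (inhabits t)).
pose mu0 (S : set (discrete_space t0)) : \bar Rdefinitions.R :=
  if `[< N S >] then 0%E else 1%E.
have mu00 : mu0 set0 = 0%E by rewrite /mu0; case: asboolP.
have mu0_ge0 S : (0 <= mu0 S)%E by rewrite /mu0; case: ifP.
have mu0_sigma : semi_sigma_additive mu0.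
  move=> F _ Ftriv _.
  have [NF|/existsNP[k NFk]] := pselect (forall k, N (F k)).
    rewrite /mu0 asboolT; last exact: Nbig.
    rewrite (_ : (fun _ => _) = (fun=> 0%E)); first exact: cvg_cst.
    by apply/funext => n; rewrite big1 // => i _; rewrite asboolT.
  rewrite {2}/mu0 asboolF => [|/NS NF]; last first.
    by apply: NFk; apply: NF => t Ft; exists k.
  (* Disjointness puts every other [F i] inside the complement of [F k], which is null, so the
     partial sums equal 1 past [k]. *)
  apply: cvg_near_cst; apply: filterS (nbhs_infty_gt k) => n /= kn.
  rewrite big_mkord (bigD1 (Ordinal kn)) //= {1}/mu0 asboolF // big1 ?adde0 //.
  move=> i /eqP neq_ik; rewrite /mu0 asboolT //.
  have [//|/NS NFC] := NC (F k); apply: NFC => t Fit Fkt; apply: neq_ik.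
  by apply: val_inj => /=; apply: Ftriv => //; exists t.
pose mu : {measure set (discrete_space t0) -> \bar Rdefinitions.R} :=
  HB.pack mu0 (isMeasure.Build _ _ _ mu0 mu00 mu0_ge0 mu0_sigma).
exists default_measure_display, (discrete_space t0), Rdefinitions.R, mu; split.
- exact: card_eqxx.
- by [].
- by move=> B; rewrite /mu /= /mu0; case: asboolP; [left|right].
- by rewrite /mu /= /mu0 asboolF.
- by move=> x; rewrite /mu /= /mu0 asboolT.
Qed.

(** * Chase's argument for an additive map from H^I to H^(J) *)

Section Chase.
Variables (H : zmodType) (I J : Type) (j0 : J) (U : nat -> set H)
  (Phi : (I -> H) -> J -> H).
Hypothesis U0 : forall n, U n 0.
Hypothesis UB : forall n x y, U n x -> U n y -> U n (x - y).
Hypothesis US : forall n, U n.+1 `<=` U n.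
Hypothesis PhiB : forall y z j, Phi (fun i => y i - z i) j = Phi y j - Phi z j.
Hypothesis PhiU : forall n y, (forall i, U n (y i)) -> forall j, U n (Phi y j).
Hypothesis Phi_finite : forall y, finite_set [set j | Phi y j <> 0].

Let UN n x : U n x -> U n (- x).
Proof. by move=> Ux; rewrite -sub0r; exact: UB. Qed.

Let UD n x y : U n x -> U n y -> U n (x + y).
Proof. by move=> Ux Uy; rewrite -[y]opprK; apply: UB => //; exact: UN. Qed.

Lemma U_leq m n : (m <= n)%N -> U n `<=` U m.
Proof.
move=> /subnK <-; elim: (n - m)%N => [//|k IHk] x.
by rewrite addSn => Ux; apply: IHk; exact: US.
Qed.

Let Phi0 j : Phi (fun=> 0) j = 0.
Proof.
rewrite -[RHS](subrr (Phi (fun=> 0) j)) -PhiB; congr (Phi _ j).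
by apply/funext => i; rewrite subr0.
Qed.

Let PhiD y z j : Phi (fun i => y i + z i) j = Phi y j + Phi z j.
Proof.
apply: (addIr (- Phi z j)); rewrite -PhiB addrK; congr (Phi _ j).
by apply/funext => i; rewrite addrK.
Qed.

Let Phi_sum (y : nat -> I -> H) n j :
  Phi (fun i => \sum_(k < n) y k i) j = \sum_(k < n) Phi (y k) j.
Proof.
elim: n => [|n IHn].
  by rewrite big_ord0 -[RHS](Phi0 j); congr (Phi _ j); apply/funext => i;
    rewrite big_ord0.
rewrite big_ord_recr /= -IHn -PhiD; congr (Phi _ j).
by apply/funext => i; rewrite big_ord_recr.
Qed.

Definition bounded n (F : set J) (A : set I) := forall y : I -> H,
  (forall i, U n (y i)) -> (forall i, ~ A i -> y i = 0) ->
  forall j, ~ F j -> forall m, U m (Phi y j).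

(** With finite [F] these sets form a sigma-ideal ([good_bigcup]); with [small] [F] only finite
    unions are needed. *)
Definition good (S : set (set J)) (A : set I) :=
  exists n F, S F /\ bounded n F A.

Lemma boundedS n n' (F G : set J) (A B : set I) :
  (n <= n')%N -> F `<=` G -> B `<=` A -> bounded n F A -> bounded n' G B.
Proof.
move=> nn' FG BA bA y yU yB j Gj m; apply: bA => [i|i Ai|].
- exact: U_leq (yU i).
- by apply: yB => /BA.
- by move/FG.
Qed.

Lemma goodS S (A B : set I) : B `<=` A -> good S A -> good S B.
Proof.
by move=> BA [n [F [SF bA]]]; exists n, F; split=> //; exact: boundedS bA.
Qed.

Lemma bounded_setU n F A B :
  bounded n F A -> bounded n F B -> bounded n F (A `|` B).
Proof.
move=> bA bB y yU yAB j Fj m.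
pose y1 i := if `[< A i >] then y i else 0.
pose y2 i := if `[< A i >] then 0 else y i.
have -> : y = (fun i => y1 i + y2 i).
  by apply/funext => i; rewrite /y1 /y2; case: asboolP; rewrite ?addr0 ?add0r.
rewrite PhiD; apply: UD.
  by apply: bA => // i; rewrite /y1; case: asboolP.
apply: bB => // i; rewrite /y2; case: asboolP => // nA nB.
by apply: yAB => -[].
Qed.

Lemma goodU S A B : (forall F G, S F -> S G -> S (F `|` G)) ->
  good S A -> good S B -> good S (A `|` B).
Proof.
move=> SU [n [F [SF bA]]] [n' [G [SG bB]]].
exists (maxn n n'), (F `|` G); split; first exact: SU.
apply: bounded_setU.
  by apply: boundedS bA; [exact: leq_maxl | exact: subsetUl | ].
by apply: boundedS bB; [exact: leq_maxr | exact: subsetUr | ].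
Qed.

Let fgood := good (@finite_set J).

Let fgoodU A B : fgood A -> fgood B -> fgood (A `|` B).
Proof. by apply: goodU => F G; rewrite finite_setU. Qed.

Lemma not_good S A : ~ good S A -> forall n F, S F ->
  exists y j m, [/\ forall i, U n (y i), forall i, ~ A i -> y i = 0,
    ~ F j & ~ U m (Phi y j)].
Proof.
move=> nA n F SF; apply: contrapT => nE; apply: nA; exists n, F; split=> //.
move=> y yU yA j Fj m; apply: contrapT => nU; apply: nE.
by exists y, j, m.
Qed.

(* Chase's argument: otherwise one builds inductively elements [y k] supported *)
(* on [B k] whose pointwise finite sum has an image with infinite support.     *)
Lemma chase (B : nat -> set I) : (forall k, B k.+1 `<=` B k) ->
  (forall i, exists k, ~ B k i) -> exists k, fgood (B k).
Proof.
move=> BS Bcap; apply: contrapT => nB.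
have B_leq k l : (k <= l)%N -> B l `<=` B k.
  move=> /subnK <-; elim: (l - k)%N => [//|p IHp] x.
  by rewrite addSn => Bx; apply: IHp; exact: BS.
have [f fP] : {f : nat * nat * set J -> (I -> H) * J * nat &
    forall s, finite_set s.2 ->
      [/\ forall i, U s.1.2 ((f s).1.1 i),
          forall i, ~ B s.1.1 i -> (f s).1.1 i = 0,
          ~ s.2 (f s).1.2 & ~ U (f s).2 (Phi (f s).1.1 (f s).1.2)]}.
  apply: (@choice _ _ (fun (s : nat * nat * set J) (r : (I -> H) * J * nat) =>
    finite_set s.2 ->
      [/\ forall i, U s.1.2 (r.1.1 i),
          forall i, ~ B s.1.1 i -> r.1.1 i = 0,
          ~ s.2 r.1.2 & ~ U r.2 (Phi r.1.1 r.1.2)])).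
  move=> [[k n] F] /=.
  have [finF|nfinF] := pselect (finite_set F); last by exists ((fun=> 0), j0, 0%N).
  have /not_good/(_ n F finF)[y [j [m yP]]] : ~ fgood (B k).
    by move=> gB; apply: nB; exists k.
  by exists (y, j, m).
(* The state is stage, level and forbidden coordinates. The next level is at least the [m] that
   detects the new image, and the support of that image becomes forbidden. *)
pose step (s : nat * nat * set J) := (s.1.1.+1, maxn s.1.2 (f s).2,
  s.2 `|` [set j | Phi (f s).1.1 j <> 0]).
pose s k := iter k step (0%N, 0%N, set0).
have s1 k : (s k).1.1 = k by elim: k => //= k ->.
have sfin k : finite_set (s k).2.
  by elim: k => [|k IHk] /=; [exact: finite_set0 | rewrite finite_setU].
pose y k := (f (s k)).1.1; pose j k := (f (s k)).1.2; pose m k := (f (s k)).2.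
pose n k := (s k).1.2.
have yU k i : U (n k) (y k i) by have [+ _ _ _] := fP _ (sfin k); exact.
have yB k i : ~ B k i -> y k i = 0.
  by have [_ + _ _] := fP _ (sfin k); rewrite s1; exact.
have jF k : ~ (s k).2 (j k) by have [_ _ + _] := fP _ (sfin k).
have yj k : ~ U (m k) (Phi (y k) (j k)) by have [_ _ _ +] := fP _ (sfin k).
have n_leq k l : (k <= l)%N -> (n k <= n l)%N.
  move=> /subnK <-; elim: (l - k)%N => [//|p IHp].
  by apply: leq_trans IHp _; exact: leq_maxl.
have F_leq k l : (k < l)%N -> (s k.+1).2 `<=` (s l).2.
  move=> /subnK <-; elim: (l - k.+1)%N => [//|p IHp] x /IHp xF.
  by rewrite addSn; left.
have Phi_y k l : (k < l)%N -> Phi (y k) (j l) = 0.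
  move=> kl; apply: contrapT => neq; apply: (jF l); apply: (F_leq k) => //.
  by right.
have [N NP] := choice Bcap.
have y0 i k : (N i <= k)%N -> y k i = 0.
  by move=> /B_leq sB; apply: yB => /sB; exact: NP.
(* At each [i] only finitely many [y k] are nonzero, so this is their infinite sum. *)
pose Y i := \sum_(k < N i) y k i.
have Yj k : Phi Y (j k) <> 0.
  (* At [j k] the terms before [k] have zero image and the tail has image in [U (m k)], whereas the
     image of [y k] is not in [U (m k)]. *)
  pose tail i := \sum_(l < N i) y (k.+1 + l)%N i.
  have -> : Y = (fun i => (\sum_(l < k.+1) y l i) + tail i).
    apply/funext => i.
    have <- : \sum_(l < N i + k.+1) y l i = Y i.
      rewrite big_split_ord /= [X in _ + X]big1 ?addr0 // => l _.
      by apply: y0; exact: leq_addr.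
    by rewrite addnC big_split_ord.
  rewrite PhiD Phi_sum big_ord_recr /= big1 ?add0r => [|l _]; last exact: Phi_y.
  have tU : U (m k) (Phi tail (j k)).
    apply: PhiU => i; rewrite /tail; apply: (@big_ind _ (U (m k))) => //.
      exact: UD.
    move=> l _; apply: U_leq (yU _ _).
    by apply: leq_trans (n_leq k.+1 _ (leq_addr _ _)); exact: leq_maxr.
  move=> sum0; apply: (yj k).
  by rewrite -[Phi (y k) _](addrK (Phi tail (j k))) sum0 sub0r; exact: UN.
have j_inj : injective j.
  move=> k l jkl; apply: contrapT => /eqP; rewrite neq_ltn => /orP[] lt_kl.
    by apply: (yj k); rewrite jkl Phi_y.
  by apply: (yj l); rewrite -jkl Phi_y.
apply: infinite_nat; rewrite (_ : setT = j @^-1` [set j | Phi Y j <> 0]).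
  by apply: finite_preimage => //; move=> a b _ _; exact: j_inj.
by apply/seteqP; split=> k _ //=.
Qed.

(** [chase] applies to what remains of the union after finitely many pieces: the remainders decrease
    to the empty set, so one of them is good. *)
Lemma good_bigcup (C : nat -> set I) :
  (forall k, fgood (C k)) -> fgood (\bigcup_k C k).
Proof.
move=> gC; pose D k := \bigcup_(l in [set l | (l < k)%N]) C l.
have gD k : fgood (D k).
  elim: k => [|k IHk].
    exists 0%N, set0; split; first exact: finite_set0.
    move=> y _ y0 j _ m; rewrite (_ : y = fun=> 0) ?Phi0 //.
    by apply/funext => i; apply: y0 => -[].
  have : fgood (D k `|` C k) by exact: fgoodU.
  apply: goodS => i [l /=]; rewrite ltnS leq_eqVlt => /orP[/eqP ->|lk]; first by right.
  by left; exists l.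
have [|i|k gB] := @chase (fun k => (\bigcup_k C k) `\` D k).
- by move=> k i [Ci nDi]; split=> // -[l /= lk Cl]; apply: nDi; exists l => //=; exact: leqW.
- have [[k _ Ck]|nC] := pselect ((\bigcup_k C k) i).
    by exists k.+1 => -[_]; apply; exists k => /=.
  by exists 0%N => -[].
- apply: goodS (fgoodU (gD k) gB) => i Ci.
  by have [|nD] := pselect (D k i); [left|right].
Qed.

Let sgood := good (@small H J).

Let fgood_sgood A : fgood A -> sgood A.
Proof.
move=> [n [F [Ffin bF]]]; exists n, F; split=> //.
exact: (finite_small 0 j0).
Qed.

Definition atom (A : set I) :=
  forall B, B `<=` A -> fgood B \/ fgood (A `\` B).

(** Otherwise every non-[sgood] set has a non-[sgood] subset whose complement in it is not [fgood].
    Iterate, and remove from each term the intersection of all: by [chase] some result is [fgood],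
    and with it a difference of consecutive terms. *)
Lemma exists_atom A0 : ~ sgood A0 -> exists A, ~ sgood A /\ atom A.
Proof.
move=> nA0; apply: contrapT => nat.
have [C CP] : {C : set I -> set I & forall A, ~ sgood A ->
    [/\ C A `<=` A, ~ sgood (C A) & ~ fgood (A `\` C A)]}.
  apply: (@choice (set I) (set I) (fun A C => ~ sgood A ->
    [/\ C `<=` A, ~ sgood C & ~ fgood (A `\` C)])) => A.
  have [sA|nsA] := pselect (sgood A); first by exists A.
  apply: contrapT => nC; apply: nat; exists A; split=> // B BA.
  apply: contrapT => /not_orP[nB nAB]; apply: nC.
  (* If [B] is [sgood], the other half cannot be, and it is kept instead. *)
  have [sB|nsB] := pselect (sgood B); last by exists B.
  exists (A `\` B) => _; split; first exact: subDsetl.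
  - move=> sAB; apply: nsA; apply: goodS (goodU _ sB sAB) => [i Ai|F G].
      by have [|nBi] := pselect (B i); [left|right].
    exact: smallU.
  - by move=> gB; apply: nB; apply: goodS gB => i Bi; split; [exact: BA|case].
pose A k := iter k C A0.
have nA k : ~ sgood (A k) by elim: k => // k /CP[].
have AS k : A k.+1 `<=` A k by have [] := CP _ (nA k).
have [||k gD] := @chase (fun k => [set i | A k i /\ exists l, ~ A l i]).
- by move=> k i /= [/AS].
- move=> i; have [[l nAi]|nAi] := pselect (exists l, ~ A l i).
    by exists l => -[].
  by exists 0%N => -[].
- have [_ _] := CP _ (nA k); apply; apply: goodS gD => i [Ai nAi].
  by split=> //; exists k.+1.
Qed.

Hypothesis Hnm : ~ omega_measurable H.

(** The sets of values with [fgood] preimage in [A] are the null sets of a countably complete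
    ultrafilter on [H], principal because |H| is not measurable. *)
Lemma atom_constant A (y : I -> H) : ~ fgood A -> atom A ->
  exists h, fgood (A `&` [set i | y i <> h]).
Proof.
move=> nA atA; pose N (S : set H) := fgood (A `&` y @^-1` S).
have [|S T ST|S|F gF|h nh] := @sigma_ultrafilter_principal H N Hnm.
- by rewrite /N preimage_setT setIT.
- by apply: goodS => i [Ai Si]; split=> //; exact: ST.
- have [|gS|gS] := atA (A `&` y @^-1` S); first by move=> i [].
    by left.
  by right; apply: goodS gS => i [Ai nSi]; split=> // -[].
- apply: goodS (good_bigcup gF) => i [Ai [k _ Fki]].
  by exists k.
- exists h; have [|//|] := atA (A `&` y @^-1` [set h]); first by move=> i [].
  by apply: goodS => i [Ai yi]; split=> // -[].
Qed.

(* An atom carries a countably complete ultrafilter, so every element is       *)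
(* constant on [A] up to a finitely good set: the constants only reach a small *)
(* set of coordinates, and the rest is handled by [good_bigcup].               *)
Lemma atom_good A : atom A -> sgood A.
Proof.
move=> atA; apply: contrapT => nsA.
have nA : ~ fgood A by move=> /fgood_sgood.
pose c h i : H := if `[< A i >] then h else 0.
pose J1 := \bigcup_h [set j | Phi (c h) j <> 0].
have step n F : finite_set F -> exists z B j, exists m,
    [/\ fgood B, forall i, U n (z i), forall i, ~ B i -> z i = 0, ~ F j
      & ~ U m (Phi z j)].
  move=> Ffin; have /not_good/(_ n (J1 `|` F))[|y [j [m [yU y0 jF yj]]]] := nsA.
    apply: smallU; last exact: (finite_small 0 j0).
    by apply: small_bigcup => // h; exact: Phi_finite.
  have [h gh] := atom_constant y nA atA.
  (* The value [h] is attained on [A]; otherwise [A] itself would be [fgood]. *)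
  have Uh : U n h.
    have [i [Ai yi]] : exists i, A i /\ y i = h.
      apply: contrapT => nh; apply: nA; apply: goodS gh => i Ai; split=> // yi.
      by apply: nh; exists i.
    by rewrite -yi.
  exists (fun i => y i - c h i), (A `&` [set i | y i <> h]), j, m; split=> //.
  - by move=> i; apply: UB => //; rewrite /c; case: asboolP.
  - move=> i nBi; rewrite /c; case: asboolP => [Ai|nAi].
      by apply/eqP; rewrite subr_eq0; apply/eqP; apply: contrapT => ?; exact: nBi.
    by rewrite subr0 y0.
  - by move=> Fj; apply: jF; right.
  - rewrite PhiB (_ : Phi (c h) j = 0) ?subr0 //.
    by apply: contrapT => ?; apply: jF; left; exists h.
have [f fP] : {f : nat * set J -> (I -> H) * set I * J & forall s,
    finite_set s.2 -> exists m,
    [/\ fgood (f s).1.2, forall i, U s.1 ((f s).1.1 i),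
      forall i, ~ (f s).1.2 i -> (f s).1.1 i = 0, ~ s.2 (f s).2
      & ~ U m (Phi (f s).1.1 (f s).2)]}.
  apply: (@choice _ _ (fun (s : nat * set J) (r : (I -> H) * set I * J) =>
    finite_set s.2 -> exists m,
    [/\ fgood r.1.2, forall i, U s.1 (r.1.1 i),
      forall i, ~ r.1.2 i -> r.1.1 i = 0, ~ s.2 r.2
      & ~ U m (Phi r.1.1 r.2)])) => -[n F] /=.
  have [Ffin|nF] := pselect (finite_set F); last by exists (fun=> 0, set0, j0).
  by have [z [B [j zP]]] := step n F Ffin; exists (z, B, j).
pose s k := iter k (fun s => (s.1.+1, (f s).2 |` s.2)) (0%N, set0).
have s1 k : (s k).1 = k by elim: k => //= k ->.
have sfin k : finite_set (s k).2.
  by elim: k => [|k IHk] /=; [exact: finite_set0 | rewrite finite_setU].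
pose j k := (f (s k)).2; pose B k := (f (s k)).1.2.
have gB k : fgood (B k) by have [m []] := fP _ (sfin k).
have js k : ~ (s k).2 (j k) by have [m []] := fP _ (sfin k).
have sj k l : (k < l)%N -> (s l).2 (j k).
  move=> /subnK <-; elim: (l - k.+1)%N => [|p IHp]; first by left.
  by rewrite addSn; right.
have j_inj : injective j.
  move=> k l jkl; apply: contrapT => /eqP; rewrite neq_ltn => /orP[] /sj.
    by rewrite jkl => /js.
  by rewrite -jkl => /js.
(* One level [n] serves the union of all the supports, so every [j (n + k)] lies in the finite set
   [F], against injectivity. *)
have [n [F [Ffin bF]]] := good_bigcup gB.
have jF k : F (j (n + k)%N).
  apply: contrapT => nF; have [m [_ zU z0 _]] := fP _ (sfin (n + k)%N); apply.
  apply: bF nF m => i; first by apply: U_leq (zU i); rewrite s1 leq_addr.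
  by move=> nB; apply: z0 => Bi; apply: nB; exists (n + k)%N.
apply: infinite_nat; rewrite (_ : setT = (fun k => j (n + k)%N) @^-1` F).
  by apply: finite_preimage => // a b _ _ /j_inj/addnI.
by apply/seteqP; split=> k _ //=; exact: jF.
Qed.

Theorem chase_nonmeasurable :
  exists n F, small H F /\ bounded n F [set: I].
Proof.
apply: contrapT => nT.
by have [A [nA /atom_good]] := @exists_atom [set: I] nT.
Qed.

End Chase.

(** * Filtered colimits and finitely presented objects *)

Lemma filtered_span (J : category) (j k l : J) (u : hom j k) (v : hom j l) :
  is_filtered J -> exists (m : J) (u' : hom k m) (v' : hom l m), u' ∘ u = v' ∘ v.
Proof.
move=> [_ ub coeq]; have [n [[a] [b]]] := ub k l.
have [m [w wab]] := coeq _ _ (a ∘ u) (b ∘ v).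
by exists m, (w ∘ a), (w ∘ b); rewrite -!compA.
Qed.

(** * Explicit filtered colimits of abelian groups *)

Section FilteredColimitAb.
Variables (J : small_category) (T : functor J Ab).
Hypothesis Jf : is_filtered J.

Let T' (j : J) : zmodType := T j.

Definition trans (j k : J) (u : hom j k) : {additive T' j -> T' k} := fmap T u.

Let trans_comp j k l (v : hom k l) (u : hom j k) x :
  trans (v ∘ u) x = trans v (trans u x).
Proof. by rewrite /trans fmap_comp. Qed.

Let stage : smallType := {j : small_Ob J & T' j}.

Definition same_germ (p q : stage) := exists (l : J)
  (u : hom (tag p : J) l) (v : hom (tag q : J) l),
  trans u (tagged p) = trans v (tagged q).

Let germ_refl p : same_germ p p.
Proof. by exists (tag p : J), (idm _), (idm _). Qed.

Let germ_sym p q : same_germ p q -> same_germ q p.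
Proof. by move=> [l [u [v uv]]]; exists l, v, u. Qed.

Let germ_trans p q r : same_germ p q -> same_germ q r -> same_germ p r.
Proof.
move=> [l [u [v uv]]] [l' [u' [v' uv']]].
have [m [w [w' ww']]] := filtered_span v u' Jf.
exists m, (w ∘ u), (w' ∘ v').
by rewrite !trans_comp uv -uv' -!trans_comp ww'.
Qed.

(** Equivalence classes as subsets of [stage], which keeps the quotient in the small universe. *)
Definition germ := {A : set stage | exists p, A = same_germ p}.

HB.instance Definition _ := gen_eqMixin germ.
HB.instance Definition _ := gen_choiceMixin germ.

Let cls (j : J) (x : T' j) : germ :=
  exist _ (same_germ (Tagged T' x)) (ex_intro _ (Tagged T' x) erefl).

Let cls_eq j k (x : T' j) (y : T' k) :
  same_germ (Tagged T' x) (Tagged T' y) <-> cls x = cls y.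
Proof.
split=> [xy|[/(congr1 (fun A : set stage => A (Tagged T' y)))]]; last first.
  by move=> ->; exact: germ_refl.
apply: eq_exist => /=; apply/seteqP; split=> r.
  by apply: germ_trans; exact: germ_sym.
exact: germ_trans.
Qed.

Let cls_surj (A : germ) : exists j (x : T' j), A = cls x.
Proof. by case: A => A [[j x] Ax]; exists j, x; exact: eq_exist. Qed.

Let cls_trans j k (u : hom j k) (x : T' j) : cls (trans u x) = cls x.
Proof.
apply/cls_eq; exists k, (idm k), u => /=.
by rewrite -trans_comp comp1m.
Qed.

Let cls_surj2 (A B : germ) :
  exists j (x y : T' j), A = cls x /\ B = cls y.
Proof.
have [[j [x ->]] [k [y ->]]] := (cls_surj A, cls_surj B).
have [_ ub _] := Jf; have [l [[u] [v]]] := ub j k.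
by exists l, (trans u x), (trans v y); rewrite !cls_trans.
Qed.

Let cls_surj3 (A B C : germ) :
  exists j (x y z : T' j), [/\ A = cls x, B = cls y & C = cls z].
Proof.
have [j [x [y [-> ->]]]] := cls_surj2 A B; have [k [z ->]] := cls_surj C.
have [_ ub _] := Jf; have [l [[u] [v]]] := ub j k.
by exists l, (trans u x), (trans u y), (trans v z); rewrite !cls_trans.
Qed.

Let clsD j k (x y : T' j) (x' y' : T' k) :
  cls x = cls x' -> cls y = cls y' -> cls (x + y) = cls (x' + y').
Proof.
move=> /cls_eq[l [u [v /= uv]]] /cls_eq[m [u' [v' /= uv']]].
have [n [w [w' ww']]] := filtered_span u u' Jf.
have [_ _ coeq] := Jf; have [o [z zww']] := coeq _ _ (w ∘ v) (w' ∘ v').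
apply/cls_eq; exists o, (z ∘ (w ∘ u)), (z ∘ (w ∘ v)) => /=.
rewrite !raddfD {2}ww' {2}zww' !trans_comp uv uv' //.
Qed.

Let add_ex (A B : germ) : exists C, forall j (x y : T' j),
  A = cls x -> B = cls y -> C = cls (x + y).
Proof.
have [j [x [y [-> ->]]]] := cls_surj2 A B.
by exists (cls (x + y)) => k x' y'; exact: clsD.
Qed.

Let add A B := sval (cid (add_ex A B)).

Let add_cls j (x y : T' j) : add (cls x) (cls y) = cls (x + y).
Proof. by rewrite /add; case: cid => C /=; apply. Qed.

Let opp_ex (A : germ) : exists B, exists j (x : T' j), A = cls x /\ B = cls (- x).
Proof. by have [j [x ->]] := cls_surj A; exists (cls (- x)), j, x. Qed.

Let opp A := sval (cid (opp_ex A)).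

Let zero_ex : exists A, forall j, A = cls (0 : T' j).
Proof.
have [[j] ub _] := Jf; exists (cls (0 : T' j)) => k.
have [l [[u] [v]]] := ub j k.
by rewrite -(cls_trans u) -(cls_trans v) !raddf0.
Qed.

Let zero := sval (cid zero_ex).

Let zeroE j : zero = cls (0 : T' j).
Proof. by rewrite /zero; case: cid. Qed.

Let addA : associative add.
Proof.
move=> A B C; have [j [x [y [z [-> -> ->]]]]] := cls_surj3 A B C.
by rewrite !add_cls addrA.
Qed.

Let addC : commutative add.
Proof.
move=> A B; have [j [x [y [-> ->]]]] := cls_surj2 A B.
by rewrite !add_cls addrC.
Qed.

Let add0 : left_id zero add.
Proof.
by move=> A; have [j [x ->]] := cls_surj A; rewrite (zeroE j) add_cls add0r.
Qed.

Let addN : left_inverse zero opp add.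
Proof.
move=> A; rewrite /opp; case: cid => B /= [j [x [-> ->]]].
by rewrite add_cls addNr -zeroE.
Qed.

Definition germ_zmod : zmodType :=
  HB.pack germ (GRing.isZmodule.Build germ addA addC add0 addN).

Lemma filtered_colimit_Ab : exists (V : zmodType)
    (i : forall j, {additive T' j -> V}),
  [/\ forall j k (u : hom j k) x, i k (trans u x) = i j x,
      forall v, exists j x, v = i j x
    & forall j x, i j x = 0 -> exists k (u : hom j k), trans u x = 0].
Proof.
have clsB j : zmod_morphism (fun x : T' j => cls x : germ_zmod).
  move=> x y; apply: (addIr (cls y : germ_zmod)); rewrite subrK.
  by transitivity (cls (x - y + y)); [exact: add_cls | rewrite subrK].
pose i j : {additive T' j -> germ_zmod} :=
  HB.pack (fun x : T' j => cls x : germ_zmod)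
    (GRing.isZmodMorphism.Build _ _ _ (clsB j)).
exists germ_zmod, i; split=> [j k u x|v|j x].
- exact: cls_trans.
- exact: cls_surj.
- move=> ix0; have /cls_eq[k [u [v /=]]] : cls x = cls (0 : T' j).
    by rewrite -zeroE; exact: ix0.
  by rewrite raddf0; exists k, u.
Qed.

End FilteredColimitAb.

Section Preadditive.
Variable A : preadditive_category.
Implicit Types X Y Z : A.

Lemma compBr X Y Z (g : hom Y Z) (f f' : hom X Y) :
  g ∘ (f - f') = g ∘ f - g ∘ f'.
Proof. exact: (raddfB (lcomp g)). Qed.

Lemma comp0r X Y Z (g : hom Y Z) : g ∘ (0 : hom X Y) = 0.
Proof. exact: (raddf0 (lcomp g)). Qed.

Lemma comp0l X Y Z (f : hom X Y) : (0 : hom Y Z) ∘ f = 0.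
Proof. by apply: (addIr (0 ∘ f)); rewrite -compDl !add0r. Qed.

Lemma compNl X Y Z (g : hom Y Z) (f : hom X Y) : (- g) ∘ f = - (g ∘ f).
Proof. by apply: (addIr (g ∘ f)); rewrite -compDl !addNr comp0l. Qed.

Lemma compBl X Y Z (g g' : hom Y Z) (f : hom X Y) :
  (g - g') ∘ f = g ∘ f - g' ∘ f.
Proof. by rewrite compDl compNl. Qed.

Lemma colimit_ext (J : category) (F : functor J A) (L L' : A)
    (c : forall j, hom (F j) L) (h h' : hom L L') :
  is_colimit c -> (forall j, h ∘ c j = h' ∘ c j) -> h = h'.
Proof.
move=> [cc univ] hh'; have [|k [_ kuniq]] := univ L' (fun j => h' ∘ c j).
  by move=> j l u; rewrite -compA cc.
by rewrite -(kuniq h hh') -(kuniq h').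
Qed.

Lemma filtered_coincide X (J : small_category) (F : functor J A) (L : A)
    (c : forall j, hom (F j) L) (j k : J) (f : hom X (F j)) (g : hom X (F k)) :
  is_filtered J -> is_cocone c ->
  (forall j (f : hom X (F j)), c j ∘ f = 0 ->
    exists k (u : hom j k), fmap F u ∘ f = 0) ->
  c j ∘ f = c k ∘ g ->
  exists l (u : hom j l) (v : hom k l), fmap F u ∘ f = fmap F v ∘ g.
Proof.
move=> [_ ub _] cc die cfg; have [l [[u] [v]]] := ub j k.
have [|m [w]] := die l (fmap F u ∘ f - fmap F v ∘ g).
  by rewrite compBr !compA !cc cfg subrr.
rewrite compBr !compA -!fmap_comp => /eqP; rewrite subr_eq0 => /eqP.
by exists m, (w ∘ u), (w ∘ v).
Qed.

Section FpColimit.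
Variables (X : A) (J : small_category) (F : functor J A) (L : A)
  (c : forall j, hom (F j) L).
Hypotheses (fpX : finitely_presented X) (Jf : is_filtered J)
  (colim_c : is_colimit c).

Let colim_c' := fpX Jf colim_c.

Lemma fp_colimit_zero j (f : hom X (F j)) :
  c j ∘ f = 0 -> exists k (u : hom j k), fmap F u ∘ f = 0.
Proof.
have [V [i [icc _ i0]]] :=
  filtered_colimit_Ab (functor_comp (Hom_functor X) F) Jf.
have [|h [hE _]] := colim_c'.2 V i.
  by move=> k l u; apply: additive_ext => x; exact: icc.
move=> cf0; have [|k [u uf0]] := i0 j f; last by exists k, u.
have /(congr1 (fun g : {additive _ -> _} => g f)) /= <- := hE j.
by rewrite /lcomp cf0 raddf0.
Qed.

(** The maps from [hom X L] to the explicit colimit and back compose to the identity, by uniqueness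
    in the universal property; so every [m] inherits a representative at some stage. *)
Lemma fp_colimit_factor (m : hom X L) : exists j (f : hom X (F j)), m = c j ∘ f.
Proof.
have [V [i [icc i_surj i0]]] :=
  filtered_colimit_Ab (functor_comp (Hom_functor X) F) Jf.
have cc := colim_c.1.
have inj j k (f : hom X (F j)) (f' : hom X (F k)) :
    i j f = i k f' -> c j ∘ f = c k ∘ f'.
  move=> ifg; have [_ ub _] := Jf; have [l [[u] [v]]] := ub j k.
  have [|n [w]] := i0 l (fmap F u ∘ f - fmap F v ∘ f').
    by rewrite raddfB /=; move: (icc _ _ u f) (icc _ _ v f') => /= -> ->; rewrite ifg subrr.
  rewrite /trans /= /lcomp => /(congr1 (fun g => c n ∘ g)).
  by rewrite compA cc comp0r compBr !compA !cc => /eqP; rewrite subr_eq0 => /eqP.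
have gex v : exists m : hom X L, forall j f, v = i j f -> m = c j ∘ f.
  by have [j [f ->]] := i_surj v; exists (c j ∘ f) => k f'; exact: inj.
pose g v := sval (cid (gex v)).
have gE j f : g (i j f) = c j ∘ f by rewrite /g; case: cid => ? /=; apply.
have gB : zmod_morphism g.
  move=> v w; have [j [f ->]] := i_surj v; have [k [f' ->]] := i_surj w.
  have [_ ub _] := Jf; have [l [[u] [u']]] := ub j k.
  by rewrite -(icc _ _ u) -(icc _ _ u') -raddfB !gE compBr.
pose g' : {additive V -> hom X L} :=
  HB.pack g (GRing.isZmodMorphism.Build _ _ _ gB).
have [|h [hE _]] := colim_c'.2 V i.
  by move=> k l u; apply: additive_ext => x; exact: icc.
have hE' j f : h (c j ∘ f) = i j f.
  by have /(congr1 (fun g : {additive _ -> _} => g f)) := hE j.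
have [|k [_ kuniq]] := colim_c'.2 (hom X L) (fun j => fmap (Hom_functor X) (c j)).
  exact: colim_c'.1.
have k1 : k = (g' \o h)%FUN :> {additive hom X L -> hom X L}.
  by apply: kuniq => j; apply: additive_ext => f /=; rewrite /lcomp hE' gE.
have k2 : k = idfun :> {additive hom X L -> hom X L}.
  by apply: kuniq => j; exact: additive_ext.
have [j [f hm]] := i_surj (h m); exists j, f.
have := congr1 (fun q : {additive _ -> _} => q m) (etrans (esym k1) k2).
by rewrite /= hm gE.
Qed.

End FpColimit.

Lemma fp_intro X :
  (forall (J : small_category) (F : functor J A) L (c : forall j, hom (F j) L),
    is_filtered J -> is_colimit c ->
    (forall m : hom X L, exists j (f : hom X (F j)), m = c j ∘ f) /\
    (forall j (f : hom X (F j)), c j ∘ f = 0 ->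
      exists k (u : hom j k), fmap F u ∘ f = 0)) ->
  finitely_presented X.
Proof.
move=> Xe J Jf F L c colim_c; have cc := colim_c.1.
have [fac die] := Xe J F L c Jf colim_c.
split=> [j k u|V c' cc'].
  by apply: additive_ext => f /=; rewrite /lcomp compA cc.
have cc'E j k (u : hom j k) (f : hom X (F j)) : c' k (fmap F u ∘ f) = c' j f.
  by have /(congr1 (fun g : {additive _ -> _} => g f)) := cc' j k u.
have inj j k (f : hom X (F j)) (f' : hom X (F k)) :
    c j ∘ f = c k ∘ f' -> c' j f = c' k f'.
  move=> /(filtered_coincide Jf cc die)[l [u [v uv]]].
  by rewrite -(cc'E _ _ u) -(cc'E _ _ v) uv.
have hex m : exists v : V, forall j f, m = c j ∘ f -> v = c' j f.
  by have [j [f ->]] := fac m; exists (c' j f) => k f'; exact: inj.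
pose h m := sval (cid (hex m)).
have hE j f : h (c j ∘ f) = c' j f by rewrite /h; case: cid => ? /=; apply.
have hB : zmod_morphism h.
  move=> v w; have [j [f ->]] := fac v; have [k [f' ->]] := fac w.
  have [_ ub _] := Jf; have [l [[u] [u']]] := ub j k.
  rewrite !hE -(cc _ _ u) -(cc _ _ u') -!compA -compBr hE raddfB.
  by rewrite !cc'E.
pose h' : {additive hom X L -> V} :=
  HB.pack h (GRing.isZmodMorphism.Build _ _ _ hB).
exists h'; split=> [j|k kE].
  by apply: additive_ext => f /=; rewrite /lcomp hE.
apply: additive_ext => m; have [j [f ->]] := fac m; rewrite /= hE.
by have /(congr1 (fun g : {additive _ -> _} => g f)) := kE j.
Qed.

End Preadditive.

(** * Colimits over a class of arrows between given objects *)

Section ConcreteDiagram.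
Variables (C : category) (I : smallType) (D : I -> C)
  (P : forall i j, hom (D i) (D j) -> Prop).
Hypothesis P_id : forall i, P (idm (D i)).
Hypothesis P_comp : forall i j k (g : hom (D j) (D k)) (f : hom (D i) (D j)),
  P g -> P f -> P (g ∘ f).

Program Definition diagram_class : category_on I :=
  {| hom_on := fun i j => {f : hom (D i) (D j) | P f};
     id_on := fun i => exist _ (idm (D i)) (P_id i);
     comp_on := fun i j k g f =>
       exist _ (sval g ∘ sval f) (P_comp (proj2_sig g) (proj2_sig f)) |}.
Next Obligation. by move=> i j [f Pf]; apply: eq_exist; exact: comp1m. Qed.
Next Obligation. by move=> i j [f Pf]; apply: eq_exist; exact: compm1. Qed.
Next Obligation. by move=> i j k l h g f; apply: eq_exist; exact: compA. Qed.

Definition diagram_shape : small_category := SmallCategory diagram_class.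

Program Definition diagram : functor diagram_shape C :=
  {| fobj := fun i : I => D i; fmap := fun i j f => sval f |}.
Next Obligation. by []. Qed.
Next Obligation. by []. Qed.

Lemma diagram_colimit : cocomplete C -> exists (L : C) (c : forall i, hom (D i) L),
  (forall i j (f : hom (D i) (D j)), P f -> c j ∘ f = c i) /\
  (forall (L' : C) (c' : forall i, hom (D i) L'),
    (forall i j (f : hom (D i) (D j)), P f -> c' j ∘ f = c' i) ->
    exists! h : hom L L', forall i, h ∘ c i = c' i).
Proof.
move=> /(_ diagram_shape diagram)[L [c [cc univ]]]; exists L, c.
split=> [i j f Pf|L' c' cc']; first exact: (cc i j (exist _ f Pf)).
by apply: univ => i j [f Pf]; exact: cc'.
Qed.

End ConcreteDiagram.

Section Cokernels.
Variable A : preadditive_category.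
Implicit Types X Y Z : A.

Definition is_cokernel X Y Z (u : hom X Y) (q : hom Y Z) :=
  q ∘ u = 0 /\ forall (W : A) (g : hom Y W), g ∘ u = 0 ->
    exists! h : hom Z W, h ∘ q = g.

Lemma cokernel_epi X Y Z (u : hom X Y) (q : hom Y Z) (W : A)
  (h h' : hom Z W) : is_cokernel u q -> h ∘ q = h' ∘ q -> h = h'.
Proof.
move=> [qu0 univ] hq; have [|k [_ kuniq]] := univ W (h' ∘ q).
  by rewrite -compA qu0 comp0r.
by rewrite -(kuniq h hq) -(kuniq h').
Qed.

Lemma exists_cokernel X Y (u : hom X Y) : cocomplete A ->
  exists (Z : A) (q : hom Y Z), is_cokernel u q.
Proof.
move=> cA; pose D b : A := if b then Y else X.
(* Making both [u] and 0 arrows of the diagram turns its colimit into the cokernel of [u]. *)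
pose P (b b' : bool) : hom (D b) (D b') -> Prop :=
  match b, b' return hom (D b) (D b') -> Prop with
  | false, false => fun f => f = idm X
  | true, true => fun f => f = idm Y
  | false, true => fun f => f = u \/ f = 0
  | true, false => fun=> False
  end.
have P1 b : P b b (idm (D b)) by case: b.
have Pc b1 b2 b3 (g : hom (D b2) (D b3)) (f : hom (D b1) (D b2)) :
    P _ _ g -> P _ _ f -> P _ _ (g ∘ f).
  case: b1 b2 b3 f g => [] [] [] //= f g.
  - by move=> -> ->; rewrite comp1m.
  - by move=> -> fE; rewrite comp1m.
  - by move=> gE ->; rewrite compm1.
  - by move=> -> ->; rewrite comp1m.
have [Z [c [cc univ]]] := diagram_colimit P1 Pc cA.
have cu : c true ∘ u = c false by apply: (cc false true); left.
have c0 : c false = 0.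
  by rewrite -(cc false true 0); [rewrite comp0r | right].
exists Z, (c true); split; first by rewrite cu.
move=> W g gu0.
pose c' b : hom (D b) W := match b return hom (D b) W with
  true => g | false => 0 end.
have [|h [hE huniq]] := univ W c'.
  case=> [] [] f //= => [->|[->|->]|->] //; rewrite ?compm1 ?comp0r //.
exists h; split=> [|k kE]; first exact: (hE true).
by apply: huniq => -[] //=; rewrite c0 comp0r.
Qed.

Lemma exists_coproduct (J : smallType) (M : A) : cocomplete A ->
  exists (S : A) (i : J -> hom M S), @is_coproduct A J (fun=> M) S i.
Proof.
move=> cA; pose P (i j : J) (f : hom M M) := i = j /\ f = idm M.
have P1 i : P i i (idm M) by [].
have Pc i j k (g f : hom M M) : P j k g -> P i j f -> P i k (g ∘ f).
  by move=> [-> ->] [-> ->]; rewrite comp1m.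
have [S [i [_ univ]]] := diagram_colimit (D := fun=> M) P1 Pc cA.
exists S, i => Y f; apply: univ => j k u [-> ->].
by rewrite compm1.
Qed.

Lemma biproduct_ext X Y S (i1 : hom X S) (i2 : hom Y S) p1 p2 W
    (f g : hom S W) : is_biproduct i1 i2 p1 p2 ->
  f ∘ i1 = g ∘ i1 -> f ∘ i2 = g ∘ i2 -> f = g.
Proof.
move=> [_ _ e] fg1 fg2; rewrite -[f]compm1 -[g]compm1 -e.
by rewrite !compDr !compA fg1 fg2.
Qed.

Lemma biproduct_copair X Y S (i1 : hom X S) (i2 : hom Y S) p1 p2 W
    (f : hom X W) (g : hom Y W) : is_biproduct i1 i2 p1 p2 ->
  exists h : hom S W, h ∘ i1 = f /\ h ∘ i2 = g.
Proof.
move=> [e1 e2 e].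
have e12 : p1 ∘ i2 = 0.
  have : p1 ∘ (i1 ∘ p1 + i2 ∘ p2) ∘ i2 = p1 ∘ i2 by rewrite e compm1.
  rewrite compDr compDl !compA e1 comp1m -[_ ∘ p2 ∘ _]compA e2 compm1.
  by move=> /(canRL (addrK _)); rewrite subrr.
have e21 : p2 ∘ i1 = 0.
  have : p2 ∘ (i1 ∘ p1 + i2 ∘ p2) ∘ i1 = p2 ∘ i1 by rewrite e compm1.
  rewrite compDr compDl !compA e2 comp1m -[_ ∘ p1 ∘ _]compA e1 compm1.
  by move=> /(canRL (addrK _)); rewrite subrr.
exists (f ∘ p1 + g ∘ p2); rewrite !compDl -!compA e1 e2 e12 e21.
by rewrite !comp0r !compm1 addr0 add0r.
Qed.

Lemma split_mono_summand X Y (i : hom X Y) (r : hom Y X) : cocomplete A ->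
  r ∘ i = idm X -> direct_summand X Y.
Proof.
move=> cA ri; have [Z [q qc]] := exists_cokernel i cA.
have [qi univ] := qc.
have [|j [jq _]] := univ Y (idm Y - i ∘ r).
  by rewrite compBl comp1m -compA ri compm1 subrr.
exists Z, i, j, r, q; split=> //; last by rewrite jq addrC subrK.
by apply: (cokernel_epi qc); rewrite -compA jq compBr compm1 compA qi comp0l
  subr0 comp1m.
Qed.

Lemma fp_biproduct X Y S (i1 : hom X S) (i2 : hom Y S) p1 p2 :
  is_biproduct i1 i2 p1 p2 -> finitely_presented X -> finitely_presented Y ->
  finitely_presented S.
Proof.
move=> bp fpX fpY; apply: fp_intro => J F L c Jf cL; have cc := cL.1; split.
  move=> m.
  have [j [f fE]] := fp_colimit_factor fpX Jf cL (m ∘ i1).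
  have [k [g gE]] := fp_colimit_factor fpY Jf cL (m ∘ i2).
  have [_ ub _] := Jf; have [l [[u] [v]]] := ub j k.
  have [h [h1 h2]] := biproduct_copair (fmap F u ∘ f) (fmap F v ∘ g) bp.
  exists l, h; apply: (biproduct_ext bp).
    by rewrite fE -compA h1 compA cc.
  by rewrite gE -compA h2 compA cc.
move=> j f cf0.
have [|k [u uf]] := @fp_colimit_zero _ _ _ _ _ _ fpX Jf cL j (f ∘ i1).
  by rewrite compA cf0 comp0l.
have [|l [v vf]] := @fp_colimit_zero _ _ _ _ _ _ fpY Jf cL k (fmap F u ∘ f ∘ i2).
  by rewrite !compA cc cf0 comp0l.
exists l, (v ∘ u); apply: (biproduct_ext bp); rewrite comp0l fmap_comp.
  by rewrite -!compA uf comp0r.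
by rewrite -vf !compA.
Qed.

Lemma fp_cokernel X Y Z (u : hom X Y) (q : hom Y Z) : is_cokernel u q ->
  finitely_presented X -> finitely_presented Y -> finitely_presented Z.
Proof.
move=> qc fpX fpY; have [qu0 univ] := qc.
apply: fp_intro => J F L c Jf cL; have cc := cL.1; split.
  move=> m; have [j [f fE]] := fp_colimit_factor fpY Jf cL (m ∘ q).
  have [|k [v vfu]] := @fp_colimit_zero _ _ _ _ _ _ fpX Jf cL j (f ∘ u).
    by rewrite compA -fE -compA qu0 comp0r.
  have [|g [gq _]] := univ _ (fmap F v ∘ f); first by rewrite -compA.
  by exists k, g; apply: (cokernel_epi qc); rewrite fE -compA gq compA cc.
move=> j f cf0.
have [|k [v vf]] := @fp_colimit_zero _ _ _ _ _ _ fpY Jf cL j (f ∘ q).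
  by rewrite compA cf0 comp0l.
by exists k, v; apply: (cokernel_epi qc); rewrite comp0l -compA.
Qed.

End Cokernels.

(** * Erasing finitely many coordinates *)

Section Truncation.
Variables (A : preadditive_category) (M : A) (J : smallType) (S L C : A)
  (i : J -> hom M S) (a : hom S L) (p : J -> hom L M) (b : hom L C).
Hypotheses (i_coprod : @is_coproduct A J (fun=> M) S i)
  (p_diag : forall j, p j ∘ (a ∘ i j) = idm M)
  (p_off : forall j k, j <> k -> p j ∘ (a ∘ i k) = 0)
  (b_coker : is_cokernel a b).

(** Used with [L] the product and [C] the quotient of M^J by M^(J), and also with [L = S], [a] the
    identity and [C] zero. *)
Definition kill j : hom L L := idm L - a ∘ i j ∘ p j.

Definition kills (s : seq J) : hom L L :=
  foldr (fun j g => kill j ∘ g) (idm L) s.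

Lemma proj_kill j k : j <> k -> p j ∘ kill k = p j.
Proof.
by move=> jk; rewrite compBr compm1 compA p_off // comp0l subr0.
Qed.

Lemma proj_killK j : p j ∘ kill j = 0.
Proof. by rewrite compBr compm1 compA p_diag comp1m subrr. Qed.

Let kill_idem j : kill j ∘ kill j = kill j.
Proof. by rewrite {1}/kill compBl comp1m -(compA (a ∘ i j)) proj_killK comp0r subr0. Qed.

Let kill_comm j k : kill j ∘ kill k = kill k ∘ kill j.
Proof.
have [->//|jk] := pselect (j = k).
have kE l m : l <> m -> kill l ∘ kill m = idm L - a ∘ i m ∘ p m - a ∘ i l ∘ p l.
  by move=> lm; rewrite {1}/kill compBl comp1m -(compA (a ∘ i l)) proj_kill.
rewrite (kE _ _ jk) (kE k j) => [|kj]; last exact: jk.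
exact: addrAC.
Qed.

Let kills_kill s j : kills s ∘ kill j = kill j ∘ kills s.
Proof.
elim: s => [|k s IHs] /=; first by rewrite comp1m compm1.
by rewrite -compA IHs !compA kill_comm.
Qed.

Let kills_cat s t : kills (s ++ t) = kills s ∘ kills t.
Proof. by elim: s => [|k s IHs] /=; rewrite ?comp1m // IHs compA. Qed.

Let kills_comm s t : kills s ∘ kills t = kills t ∘ kills s.
Proof.
elim: s => [|k s IHs] /=; first by rewrite comp1m compm1.
by rewrite -compA IHs !compA kills_kill.
Qed.

Let kills_idem s : kills s ∘ kills s = kills s.
Proof.
elim: s => [|k s IHs] /=; first by rewrite comp1m.
by rewrite -compA [kills s ∘ _]compA kills_kill !compA kill_idem -compA IHs.
Qed.

Lemma proj_kills j s : p j ∘ kills s = p j \/ p j ∘ kills s = 0.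
Proof.
elim: s => [|k s IHs] /=; first by rewrite compm1; left.
rewrite compA; have [->|jk] := pselect (j = k); last by rewrite proj_kill.
by right; rewrite proj_killK comp0l.
Qed.

Lemma kills_finite s : finite_set [set j | p j ∘ kills s <> p j].
Proof.
elim: s => [|k s IHs] /=.
  rewrite (_ : [set _ | _] = set0); first exact: finite_set0.
  by apply/seteqP; split=> j //=; rewrite compm1.
apply: (@sub_finite_set _ _ (k |` [set j | p j ∘ kills s <> p j])).
  move=> j /=; have [->|jk] := pselect (j = k); first by left.
  by rewrite compA proj_kill //; right.
by rewrite finite_setU.
Qed.

Lemma kills_retract s : exists t : hom L S, idm L - kills s = a ∘ t.
Proof.
elim: s => [|j s [t tE]] /=; first by exists 0; rewrite subrr comp0r.
exists (t + i j ∘ p j ∘ kills s).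
by rewrite compDr -tE compBl comp1m opprB !compA addrA addrAC.
Qed.

Let P (u v : unit) (f : hom L L) := exists s, f = kills s.

Let P_id u : P u u (idm L).
Proof. by exists [::]. Qed.

Let P_comp u v w (g f : hom L L) : P v w g -> P u v f -> P u w (g ∘ f).
Proof. by move=> [s ->] [t ->]; exists (s ++ t); rewrite kills_cat. Qed.

Let E := diagram_shape (D := fun=> L) P_id P_comp.

Let E_filtered : is_filtered E.
Proof.
split=> [|u v|u v [f [s fE]] [g [t gE]]]; first exact: (inhabits tt).
  by exists tt; split; exact: (inhabits (exist _ (idm L) (P_id tt))).
(* The operators are commuting idempotents, so [kills (s ++ t)] absorbs both [kills s] and
   [kills t]. *)
exists tt, (exist _ (kills (s ++ t)) (ex_intro _ (s ++ t) erefl)).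
apply: eq_exist; rewrite /= fE gE kills_cat.
by rewrite {1}kills_comm -!compA !kills_idem kills_comm.
Qed.

(* The cokernel of [a] is the filtered colimit of the one-object diagram on    *)
(* [L] whose arrows are the operators erasing finitely many coordinates.       *)
Let E_colimit : @is_colimit E A (diagram P_id P_comp) C (fun=> b).
Proof.
have [ba univ] := b_coker; split=> [u v [f [s fE]]|Y c' cc'] /=.
  rewrite {}fE; elim: s => [|j s IHs] /=; first by rewrite compm1.
  by rewrite compA compBr compm1 !compA ba !comp0l subr0.
have [|h [hb huniq]] := univ Y (c' tt).
  (* [c' tt ∘ a] vanishes on each summand: compatibility with [kill j] annihilates [a ∘ i j ∘ p j],
     and [a ∘ i j] is a section of [p j]. *)
  have [z [_ zuniq]] := i_coprod (fun=> (0 : hom M Y)).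
  rewrite -(zuniq (c' tt ∘ a)) => [|j]; first by apply: zuniq => j; rewrite comp0l.
  have := cc' tt tt (exist _ (kills [:: j]) (ex_intro _ [:: j] erefl)).
  rewrite /= compm1 /kill compBr compm1 => /(congr1 (fun z => c' tt - z)).
  rewrite opprB addrC subrK subrr => /(congr1 (fun g => g ∘ (a ∘ i j))).
  by rewrite comp0l -!compA p_diag compm1.
exists h; split=> [[]//|k kE]; apply: huniq; exact: (kE tt).
Qed.

Variable X : A.
Hypothesis fpX : finitely_presented X.

Lemma truncation_factor (m : hom X C) : exists f : hom X L, m = b ∘ f.
Proof.
by have [v [f fE]] := fp_colimit_factor fpX E_filtered E_colimit m; exists f.
Qed.

Lemma truncation_zero (f : hom X L) : b ∘ f = 0 -> exists s, kills s ∘ f = 0.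
Proof.
move=> bf0.
have [v [[u [s uE]] uf]] :=
  @fp_colimit_zero _ _ _ _ _ _ fpX E_filtered E_colimit tt f bf0.
by exists s; rewrite -uE.
Qed.

End Truncation.

(** * Locally finitely presented categories *)

Section LocallyFinitelyPresented.
Variable A : preadditive_category.
Hypothesis lfpA : locally_finitely_presented A.

Let cocompA : cocomplete A. Proof. by have [] := lfpA. Qed.

Lemma fp_jointly_epi (L L' : A) (h h' : hom L L') :
  (forall X (x : hom X L), finitely_presented X -> h ∘ x = h' ∘ x) -> h = h'.
Proof.
move=> hh'; have [_ _ _ /(_ L)[J [F [c [_ Ffp cL]]]]] := lfpA.
by apply: (colimit_ext cL) => j; exact: hh'.
Qed.

(** The values of [R] on a filtered colimit cocone over [L] form a cocone by coherence. Taking [v]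
    an identity, coherence also makes values unique. *)
Lemma fp_dense (L L' : A) (R : forall X : A, hom X L -> hom X L' -> Prop) :
  (forall X x, finitely_presented X -> exists n, R X x n) ->
  (forall X Y (v : hom X Y) y n m, finitely_presented X ->
    finitely_presented Y -> R Y y n -> R X (y ∘ v) m -> m = n ∘ v) ->
  exists h : hom L L', forall X x n, finitely_presented X -> R X x n -> h ∘ x = n.
Proof.
move=> Rtot Rcoh; have [_ _ _ /(_ L)[J [F [c [Jf Ffp cL]]]]] := lfpA.
pose n j := sval (cid (Rtot _ (c j) (Ffp j))).
have nP j : R _ (c j) (n j) by rewrite /n; case: cid.
have [|h [hc _]] := cL.2 L' n.
  move=> j k u; symmetry; apply: (Rcoh _ _ (fmap F u) (c k)) => //.
  by rewrite cL.1.
exists h => X x m fpX Rxm; have [j [f xE]] := fp_colimit_factor fpX Jf cL x.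
rewrite xE compA hc; symmetry; apply: (Rcoh _ _ f (c j)) => //.
by rewrite -xE.
Qed.

Variables (J0 : smallType) (G : J0 -> A).
Hypotheses (fpG : forall k, finitely_presented (G k))
  (isoG : forall X, finitely_presented X -> exists k, isomorphic X (G k)).

Definition is_sum (X1 X2 Y : A) (i1 : hom X1 Y) (i2 : hom X2 Y) :=
  (forall W (f : hom X1 W) (g : hom X2 W),
    exists h : hom Y W, h ∘ i1 = f /\ h ∘ i2 = g) /\
  (forall W (h h' : hom Y W), h ∘ i1 = h' ∘ i1 -> h ∘ i2 = h' ∘ i2 -> h = h').

Lemma fp_sum (X1 X2 : A) : finitely_presented X1 -> finitely_presented X2 ->
  exists k (i1 : hom X1 (G k)) (i2 : hom X2 (G k)), is_sum i1 i2.
Proof.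
move=> fp1 fp2; have [[_ bip] _ _ _] := lfpA.
have [S [i1 [i2 [p1 [p2 bp]]]]] := bip X1 X2.
have [k [f [g [gf fg]]]] := isoG (fp_biproduct bp fp1 fp2).
exists k, (f ∘ i1), (f ∘ i2); split=> [W u v|W h h'].
  have [h [<- <-]] := biproduct_copair u v bp; exists (h ∘ g).
  by rewrite !compA -(compA h) gf compm1.
rewrite !compA => h1 h2; have := biproduct_ext bp h1 h2.
by move=> /(congr1 (fun z => z ∘ g)); rewrite -!compA fg !compm1.
Qed.

(** Families indexed by [T] stand for maps into M^T before that product is known to exist. *)
Lemma fp_join (T : smallType) (M X1 X2 : A) (y1 : T -> hom X1 M)
    (y2 : T -> hom X2 M) : finitely_presented X1 -> finitely_presented X2 ->
  exists k (u1 : hom X1 (G k)) (u2 : hom X2 (G k)) (y : T -> hom (G k) M),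
    (forall t, y t ∘ u1 = y1 t) /\ (forall t, y t ∘ u2 = y2 t).
Proof.
move=> fp1 fp2; have [k [i1 [i2 [copair _]]]] := fp_sum fp1 fp2.
have [y yP] := choice (fun t => copair M (y1 t) (y2 t)).
by exists k, i1, i2, y; split=> t; have [] := yP t.
Qed.

Lemma fp_cokernel_small X Y (u : hom X Y) :
  finitely_presented X -> finitely_presented Y ->
  exists k (q : hom Y (G k)), is_cokernel u q.
Proof.
move=> fpX fpY; have [Z [q qc]] := exists_cokernel u cocompA.
have [k [f [g [gf fg]]]] := isoG (fp_cokernel qc fpX fpY).
have [qu0 univ] := qc; exists k, (f ∘ q); split.
  by rewrite -compA qu0 comp0r.
move=> W w wu0; have [h [hq huniq]] := univ W w wu0.
exists (h ∘ g); split=> [|h' h'q].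
  by rewrite compA -(compA h) gf compm1.
by rewrite (huniq (h' ∘ f)) -?compA ?fg ?compm1.
Qed.

Lemma fp_coequalize (T : smallType) (M X Y : A) (f g : hom X Y)
    (y : T -> hom Y M) : finitely_presented X -> finitely_presented Y ->
  (forall t, y t ∘ f = y t ∘ g) ->
  exists k (q : hom Y (G k)) (y' : T -> hom (G k) M),
    (forall t, y' t ∘ q = y t) /\ q ∘ f = q ∘ g.
Proof.
move=> fpX fpY yfg; have [k [q [qu0 univ]]] := fp_cokernel_small (f - g) fpX fpY.
have [y' y'P] : {y' : T -> hom (G k) M & forall t, y' t ∘ q = y t}.
  apply: (@choice _ _ (fun t (y' : hom (G k) M) => y' ∘ q = y t)) => t.
  have [|h [hq _]] := univ M (y t); first by rewrite compBr yfg subrr.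
  by exists h.
exists k, q, y'; split=> //.
by move: qu0; rewrite compBr => /eqP; rewrite subr_eq0 => /eqP.
Qed.

(** * Products as filtered colimits of finitely presented objects *)

Section Products.
Variables (T : smallType) (M : A).

Let I : smallType := {k : J0 & T -> hom (G k) M}.
Let D (e : I) : A := G (tag e).
Let P (e e' : I) (u : hom (D e) (D e')) := forall t, tagged e' t ∘ u = tagged e t.

Let P_id e : P (idm (D e)).
Proof. by move=> t; rewrite compm1. Qed.

Let P_comp e1 e2 e3 (g : hom (D e2) (D e3)) (f : hom (D e1) (D e2)) :
  P g -> P f -> P (g ∘ f).
Proof. by move=> Pg Pf t; rewrite compA Pg. Qed.

Let E := diagram_shape P_id P_comp.

Let E_filtered : is_filtered E.
Proof.
split=> [|[k1 y1] [k2 y2]|[k1 y1] [k2 y2] [f Pf] [g Pg]].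
(* Any finitely presented object with the zero family is an index; one occurs in a diagram whose
   colimit is the zero object. *)
- have [[[Z _] _] _ _ /(_ Z)[J [F [c [[[j] _ _] Ffp _]]]]] := lfpA.
  by have [k _] := isoG (Ffp j); apply: inhabits; exists k => t; exact: 0.
- have [k [u1 [u2 [y [yu1 yu2]]]]] := fp_join y1 y2 (fpG k1) (fpG k2).
  exists (Tagged (fun k => T -> hom (G k) M) y).
  by split; apply: inhabits; [exists u1 | exists u2].
- have [t|k [q [y [yq qfg]]]] := @fp_coequalize T M _ _ f g y2 (fpG k1) (fpG k2).
    by rewrite (Pf t) (Pg t).
  exists (Tagged (fun k => T -> hom (G k) M) y), (exist _ q yq).
  by apply: eq_exist => /=.
Qed.

(** The indices are the elements of the presheaf Hom(-, M)^T on finitely presented objects. They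
    form a filtered category, so [Q] represents this presheaf there, and [fp_dense] extends this to
    every [Y]. *)
Lemma exists_product :
  exists (Q : A) (p : T -> hom Q M), @is_product A T (fun=> M) Q p.
Proof.
have [Q [c cQ]] := cocompA (diagram P_id P_comp).
have [p pP] : {p : T -> hom Q M & forall t (e : I), p t ∘ c e = tagged e t}.
  apply: (@choice _ _ (fun t (p : hom Q M) => forall e : I, p ∘ c e = tagged e t)).
  move=> t; have [|h [hc _]] := cQ.2 M (fun e : I => tagged e t); last by exists h.
  by move=> e e' [u Pu]; exact: Pu.
(* Every [m : X -> Q] is the canonical map attached to the family [p t ∘ m].   *)
have canon X : finitely_presented X -> exists k (f : hom X (G k)) (g : hom (G k) X),
    g ∘ f = idm X /\ forall m : hom X Q,
      m = c (Tagged (fun k => T -> hom (G k) M) (fun t => p t ∘ m ∘ g)) ∘ f.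
  move=> fpX; have [k [f [g [gf fg]]]] := isoG fpX; exists k, f, g.
  split=> // m; have [e [u mE]] := fp_colimit_factor fpX E_filtered cQ m.
  set e' := Tagged _ _.
  have Pu : @P e' e (u ∘ g).
    by move=> t; rewrite /e' /= mE (compA (p t)) pP compA.
  have := cQ.1 e' e (exist _ (u ∘ g) Pu) => /= <-.
  by rewrite -compA -compA gf compm1.
have inj X (m m' : hom X Q) : finitely_presented X ->
    (forall t, p t ∘ m = p t ∘ m') -> m = m'.
  move=> /canon[k [f [g [_ mE]]]] mm'; rewrite (mE m) (mE m').
  congr (c (Tagged _ _) ∘ f); apply/funext => t.
  by rewrite mm'.
have surj X (y : T -> hom X M) : finitely_presented X ->
    exists m, forall t, p t ∘ m = y t.
  move=> /canon[k [f [g [gf _]]]].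
  exists (c (Tagged (fun k => T -> hom (G k) M) (fun t => y t ∘ g)) ∘ f) => t.
  by rewrite compA pP /= -compA gf compm1.
exists Q, p => Y y.
have [|X Z v z n m fpX fpZ nE mE|h hE] := @fp_dense Y Q
  (fun X x m => forall t, p t ∘ m = y t ∘ x).
- by move=> X x fpX; exact: surj.
- by apply: inj => // t; rewrite mE !compA nE.
exists h; split=> [t|h' h'E].
  apply: fp_jointly_epi => X x fpX.
  by have [m mE] := surj X (fun t => y t ∘ x) fpX; rewrite -compA (hE _ _ m).
apply: fp_jointly_epi => X x fpX; apply: hE => // t.
by rewrite compA h'E.
Qed.

End Products.
End LocallyFinitelyPresented.

(** * Purity and the descending chain condition *)

Section Coproducts.
Variables (A : preadditive_category) (M : A) (J : smallType) (S : A)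
  (i : J -> hom M S).
Hypothesis i_coprod : @is_coproduct A J (fun=> M) S i.

Lemma coproduct_proj : exists p : J -> hom S M,
  (forall j, p j ∘ i j = idm M) /\ (forall j k, j <> k -> p j ∘ i k = 0).
Proof.
pose d (j k : J) : hom M M := if `[< j = k >] then idm M else 0.
have [p pP] : {p : J -> hom S M & forall j k, p j ∘ i k = d j k}.
  apply: (@choice _ _ (fun j (p : hom S M) => forall k, p ∘ i k = d j k)) => j.
  by have [p [pE _]] := i_coprod (d j); exists p.
exists p; split=> [j|j k jk]; rewrite pP /d; first by rewrite asboolT.
by rewrite asboolF.
Qed.

Variables (p : J -> hom S M) (X : A).
Hypotheses (p_diag : forall j, p j ∘ i j = idm M)
  (p_off : forall j k, j <> k -> p j ∘ i k = 0)
  (fpX : finitely_presented X) (addA : is_additive A).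

(** Truncation with [a] the identity: its cokernel is the zero object, where every morphism dies. *)
Lemma coproduct_kills (f : hom X S) : exists s, kills i (idm S) p s ∘ f = 0.
Proof.
have [[Z [Zinit Zterm]] _] := addA.
apply: (@truncation_zero _ M J S S Z i (idm S) p 0) => // [j|j k||].
- by rewrite comp1m.
- by rewrite comp1m; exact: p_off.
- split; first exact: comp0l.
  move=> W g; rewrite compm1 => ->; have [h [_ hu]] := Zinit W.
  by exists h; split=> [|h' _]; [rewrite comp0r | exact: hu].
- by rewrite comp0l.
Qed.

Lemma coproduct_support (f : hom X S) : finite_set [set j | p j ∘ f <> 0].
Proof.
have [s sf] := coproduct_kills f.
apply: sub_finite_set (kills_finite (i := i) (a := idm S) (p := p) _ s).
  move=> j /= pf pE; apply: pf; rewrite -pE -compA sf.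
  exact: comp0r.
by move=> j k; rewrite comp1m; exact: p_off.
Qed.

Lemma coproduct_eq0 (f : hom X S) : (forall j, p j ∘ f = 0) -> f = 0.
Proof.
move=> pf; have [s <-] := coproduct_kills f.
elim: s => [|j s IHs] /=; first by rewrite comp1m.
by rewrite -compA -IHs /kill compBl -!compA pf !comp0r subr0 comp1m.
Qed.

Definition factors (Z N : A) (w : hom X Z) (x : hom X N) :=
  exists z : hom Z N, x = z ∘ w.

Lemma coproduct_factors (Z : A) (w : hom X Z) (f : hom X S) :
  (forall j, factors w (p j ∘ f)) -> factors w f.
Proof.
move=> pf; have [s sf] := coproduct_kills f.
suff : factors w (f - kills i (idm S) p s ∘ f) by rewrite sf subr0.
elim: s {sf} => [|j s [z zE]] /=.
  by exists 0; rewrite comp1m subrr comp0l.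
have [z' z'E] : factors w (p j ∘ kills i (idm S) p s ∘ f).
  have [||->|->] := @proj_kills A M J S S i (idm S) p _ _ j s.
  - by move=> k; rewrite comp1m.
  - by move=> k l; rewrite comp1m; exact: p_off.
  - exact: pf.
  - by exists 0; rewrite !comp0l.
exists (z + i j ∘ z'); rewrite compDl -zE -(compA (i j)) -z'E.
by rewrite /kill comp1m !compBl comp1m opprB !compA addrA addrAC.
Qed.

End Coproducts.

Section Purity.
Variable A : preadditive_category.
Hypothesis lfpA : locally_finitely_presented A.

(** A map from a finitely presented object that dies in the cokernel has finitely many nonzero
    coordinates, so it comes from the coproduct; maps into the cokernel lift by
    [truncation_factor]. *)
Lemma pure_coproduct_product (M : A) (J : smallType) (S Q : A)
    (i : J -> hom M S) (q : J -> hom Q M) :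
  @is_coproduct A J (fun=> M) S i -> @is_product A J (fun=> M) Q q ->
  exists a : hom S Q, pure_mono a.
Proof.
move=> i_coprod q_prod; have [addA cocompA _ _] := lfpA.
have [p [p_diag p_off]] := coproduct_proj i_coprod.
have [a [aE _]] := q_prod S p.
have [C [b bc]] := exists_cokernel a cocompA.
have q_diag j : q j ∘ (a ∘ i j) = idm M by rewrite compA aE.
have q_off j k : j <> k -> q j ∘ (a ∘ i k) = 0 by rewrite compA aE; exact: p_off.
exists a, C, b => X fpX; split.
- move=> f g /= afg; apply/eqP; rewrite -subr_eq0; apply/eqP.
  apply: (coproduct_eq0 i_coprod p_diag p_off) => // j.
  by rewrite compBr -aE -!compA [a ∘ f]afg subrr.
- apply/seteqP; split=> f /=.
    by move=> [g _ <-]; rewrite /lcomp compA bc.1 comp0l.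
  rewrite /lcomp => /(truncation_zero i_coprod q_diag q_off bc fpX)[s sf].
  have [t tE] := kills_retract i a q s.
  by exists (t ∘ f) => //; rewrite /lcomp compA -tE compBl comp1m sf subr0.
- apply/seteqP; split=> // m _.
  by have [f ->] := truncation_factor i_coprod q_diag q_off bc fpX m; exists f.
Qed.

Lemma Sigma_pure_injective_Add_Prod (M : A) :
  Sigma_pure_injective M -> forall N : A, Add M N -> Prod M N.
Proof.
have [addA cocompA [J0 [G [fpG isoG]]] _] := lfpA.
move=> SpiM N [J [S [i [i_coprod [N' [i1 [i2 [p1 [p2 [pi1 _ _]]]]]]]]]].
have [Q [q q_prod]] := exists_product lfpA fpG isoG J M.
have [a pa] := pure_coproduct_product i_coprod q_prod.
have [r ra] := SpiM J S i i_coprod S Q a pa (idm S).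
exists J, Q, q; split=> //.
apply: (@split_mono_summand _ _ _ (a ∘ i1) (p1 ∘ r)) => //.
by rewrite -compA (compA r) ra comp1m.
Qed.

(** One stationary step per chain suffices: a chain that never stabilizes has a strictly descending
    subchain. *)
Definition definable_dcc (X N : A) :=
  forall (Z : nat -> A) (w : forall n, hom X (Z n))
    (t : forall n, hom (Z n) (Z n.+1)), (forall n, w n.+1 = t n ∘ w n) ->
  exists n, forall x : hom X N, factors (w n) x -> factors (w n.+1) x.

Lemma definable_dcc_coproduct (X M : A) (J : smallType) (S : A)
    (i : J -> hom M S) : @is_coproduct A J (fun=> M) S i ->
  finitely_presented X -> definable_dcc X M -> definable_dcc X S.
Proof.
move=> i_coprod fpX dccM Z w t wt; have [n nM] := dccM Z w t wt.
have [p [p_diag p_off]] := coproduct_proj i_coprod; exists n => x [z xE].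
have [addA _ _ _] := lfpA.
apply: (coproduct_factors i_coprod p_diag p_off) => // j; apply: nM.
by exists (p j ∘ z); rewrite xE compA.
Qed.

Lemma Add_Prod_definable_dcc (X M : A) : finitely_presented X ->
  ~ omega_measurable (hom X M) -> (forall N : A, Add M N -> Prod M N) ->
  definable_dcc X M.
Proof.
move=> fpX nmeas AddProd Z w t wt; apply: contrapT => nstat.
have [addA cocompA _ _] := lfpA.
pose H : zmodType := hom X M.
have [h hP] : {h : nat -> H & forall n, factors (w n) (h n) /\
    ~ factors (w n.+1) (h n)}.
  apply: (@choice nat H (fun n h => factors (w n) h /\ ~ factors (w n.+1) h)).
  move=> n; apply: contrapT => nh; apply: nstat; exists n => x xn.
  by apply: contrapT => nx; apply: nh; exists x.
(* A power set is not covered by [nat * H], so it exceeds every [small] set. *)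
pose J : smallType := set (nat * H).
have [S [i i_coprod]] := exists_coproduct J M cocompA.
have [p [p_diag p_off]] := coproduct_proj i_coprod.
have [|I [Q [q [q_prod [S' [i1 [i2 [p1 [p2 [pi1 _ _]]]]]]]]]] := AddProd S.
  exists J, S, i; split=> //.
  by apply: (@split_mono_summand _ _ _ (idm S) (idm S)) => //; exact: comp1m.
pose hat (y : I -> H) : hom X Q := sval (cid (q_prod X y)).
have hatE y k : q k ∘ hat y = y k by rewrite /hat; case: cid => m /= [].
have hat_uniq y m : (forall k, q k ∘ m = y k) -> hat y = m.
  by rewrite /hat; case: cid => m' /= [_ mu] mE; exact: mu.
pose Phi (y : I -> H) (j : J) : H := p j ∘ (p1 ∘ hat y).
pose U n : set H := [set x | factors (w n) x].
have [|n x y [z ->] [z' ->]|n x [z ->]|y z j|n y yU j|y|//|n [F [[f Ff] bF]]] :=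
  @chase_nonmeasurable H I J (set0 : J) U Phi.
- by move=> n; exists 0; rewrite comp0l.
- by exists (z - z'); rewrite compBl.
- by exists (z ∘ t n); rewrite wt compA.
- rewrite /Phi (_ : hat _ = hat y - hat z) ?compBr //.
  by apply: hat_uniq => k; rewrite compBr !hatE.
- have [z zE] := choice yU; have [m [mE _]] := q_prod (Z n) z.
  exists (p j ∘ (p1 ∘ m)); rewrite /Phi -!compA; congr (_ ∘ (_ ∘ _)).
  by apply: hat_uniq => k; rewrite compA mE zE.
- exact: (coproduct_support i_coprod).
(* Cantor's diagonal set for [f], hence outside [F]. *)
pose j : J := [set x | ~ f x x].
have nFj : ~ F j.
  move=> /Ff[x _ fx]; have fxx : f x x = j x by rewrite fx.
  have nj : ~ j x by move=> jx; have nfx : ~ f x x := jx; apply: nfx; rewrite fxx.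
  by have jx : j x := fun ffx => nj (eq_ind _ id ffx _ fxx); exact: nj.
have [[z zE] nh] := hP n; apply: nh.
(* [h n] placed at coordinate [j] and embedded in M^I; [Phi] recovers it at [j], so [h n] would lie
   in every [U m]. *)
pose y k : H := q k ∘ (i1 ∘ (i j ∘ h n)).
have := bF y _ _ j nFj n.+1.
have -> : Phi y j = h n.
  by rewrite /Phi (hat_uniq y _ (fun=> erefl)) !compA -(compA (p j)) pi1 compm1
    p_diag comp1m.
apply=> [k|k []//]; exists (q k ∘ (i1 ∘ (i j ∘ z))).
by rewrite /y zE !compA.
Qed.

End Purity.

(** * The chain condition implies pure-injectivity *)

Section DccPureInjective.
Variable A : preadditive_category.
Hypothesis lfpA : locally_finitely_presented A.
Variables (J0 : smallType) (G : J0 -> A).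
Hypotheses (fpG : forall k, finitely_presented (G k))
  (isoG : forall X, finitely_presented X -> exists k, isomorphic X (G k)).

Lemma definable_dcc_min (X M : A) (P : forall k, hom X (G k) -> Prop) :
  definable_dcc X M -> (exists k w, P k w) ->
  exists k (w : hom X (G k)), P k w /\ forall l (t : hom (G k) (G l)),
    P l (t ∘ w) -> forall x : hom X M, factors w x -> factors (t ∘ w) x.
Proof.
move=> dccM [k0 [w0 Pw0]]; apply: contrapT => nmin.
pose E : smallType := {k : J0 & {w : hom X (G k) | P k w}}.
pose wt (e : E) : hom X (G (tag e)) := sval (tagged e).
have next (e : E) : {e' : E | exists t : hom (G (tag e)) (G (tag e')),
    wt e' = t ∘ wt e /\ ~ forall x : hom X M, factors (wt e) x -> factors (wt e') x}.
  apply: cid; apply: contrapT => nE; apply: nmin.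
  exists (tag e), (wt e); split=> [|l t Ptw]; first exact: (proj2_sig (tagged e)).
  apply: contrapT => nf; apply: nE.
  exists (Tagged (fun k => {w : hom X (G k) | P k w}) (exist _ (t ∘ wt e) Ptw)).
  by exists t.
have [e [_ eS]] := dependent_choice next
  (Tagged (fun k => {w : hom X (G k) | P k w}) (exist _ w0 Pw0)).
pose t n := sval (cid (eS n)).
have tP n : wt (e n.+1) = t n ∘ wt (e n) /\
    ~ forall x : hom X M, factors (wt (e n)) x -> factors (wt (e n.+1)) x.
  by rewrite /t; case: cid.
have [n nM] := dccM _ (fun n => wt (e n)) t (fun n => (tP n).1).
by have [_] := tP n.
Qed.

Variables (K L C N : A) (a : hom K L) (b : hom L C) (f : hom K N).
Hypotheses (ab_pure : pure_exact a b)
  (dccN : forall k, definable_dcc (G k) N).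

(** An entry in the graph of a partial map from [L] to [N], over a finitely presented source. *)
Let elt : smallType := {k : J0 & (hom (G k) L * hom (G k) N)%type}.
Let Elt k (x : hom (G k) L) (n : hom (G k) N) : elt :=
  Tagged (fun k => (hom (G k) L * hom (G k) N)%type) (x, n).
Let src (e : elt) : A := G (tag e).
Let pt (e : elt) : hom (src e) L := (tagged e).1.
Let im (e : elt) : hom (src e) N := (tagged e).2.

Let le (e e' : elt) :=
  exists u : hom (src e) (src e'), pt e' ∘ u = pt e /\ im e' ∘ u = im e.

Let le_trans e1 e2 e3 : le e1 e2 -> le e2 e3 -> le e1 e3.
Proof.
move=> [u [u1 u2]] [v [v1 v2]]; exists (v ∘ u).
by rewrite !compA v1 v2.
Qed.

(* The type of [pt e] over the finitely presented objects is realized by       *)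
(* [im e].                                                                     *)
Definition tame (e : elt) := forall k (u : hom (src e) (G k)) (y : hom (G k) L),
  y ∘ u = pt e -> exists h : hom (G k) N, h ∘ u = im e.

Definition directed_tame (Gm : set elt) := (forall e, Gm e -> tame e) /\
  forall e e', Gm e -> Gm e' -> exists e3, [/\ Gm e3, le e e3 & le e' e3].

Definition base : set elt := [set e |
  exists k : hom (src e) K, pt e = a ∘ k /\ im e = f ∘ k].

Let pure_inj X (g g' : hom X K) : finitely_presented X -> a ∘ g = a ∘ g' -> g = g'.
Proof. by move=> fpX; have [inj _ _] := ab_pure fpX; exact: inj. Qed.

Let pure_ker X (g : hom X L) : finitely_presented X -> b ∘ g = 0 ->
  exists h, a ∘ h = g.
Proof.
move=> fpX bg0; have [_ /seteqP[_ /(_ g bg0)[h _ hE]] _] := ab_pure fpX.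
by exists h.
Qed.

Let pure_lift X (g : hom X C) : finitely_presented X -> exists h, b ∘ h = g.
Proof.
move=> fpX; have [_ _ /seteqP[_ /(_ g I)[h _ hE]]] := ab_pure fpX.
by exists h.
Qed.

Let ba0 X (g : hom X K) : finitely_presented X -> b ∘ (a ∘ g) = 0.
Proof.
by move=> fpX; have [_ /seteqP[+ _] _] := ab_pure fpX; apply; exists g.
Qed.

Lemma base_directed_tame : directed_tame base.
Proof.
split=> [e [k [ek en]] l u y yu|e e' [k [ek en]] [k' [ek' en']]].
  have [m [q qc]] := fp_cokernel_small lfpA isoG u (fpG (tag e)) (fpG l).
  have [qu0 univ] := qc.
  have [|z [zq _]] := univ C (b ∘ y); first by rewrite -compA yu ek; exact: ba0 (fpG _).
  have [w bw] := pure_lift z (fpG m).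
  have [|t tE] := pure_ker (g := y - w ∘ q) (fpG l).
    by rewrite compBr compA bw zq subrr.
  exists (f ∘ t); rewrite -compA en; congr (_ ∘ _).
  apply: pure_inj; first exact: fpG.
  by rewrite compA tE compBl yu -compA qu0 comp0r subr0 ek.
have [l [u [u' [y [yu yu']]]]] := fp_join lfpA isoG (fun _ : unit => k)
  (fun=> k') (fpG (tag e)) (fpG (tag e')).
exists (Elt (a ∘ y tt) (f ∘ y tt)); split; first by exists (y tt).
- by exists u; rewrite /pt /im /= -!compA yu.
- by exists u'; rewrite /pt /im /= -!compA yu'.
Qed.

(** * Extending a partial map to one more point *)

Section Extension.
Variables (Gm : set elt) (k0 : J0) (x : hom (G k0) L).
Hypotheses (Gm_ok : directed_tame Gm) (Gm0 : Gm !=set0).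

(** Maps factoring through [q ∘ u] are the values at [x] of the [h] with [h ∘ u' = 0], that is, the
    differences of values compatible with [im e]. *)
Let family k (w : hom (G k0) (G k)) := exists e l (u : hom (G k0) (G l))
  (u' : hom (src e) (G l)) (y : hom (G l) L) (q : hom (G l) (G k)),
  [/\ Gm e, y ∘ u = x, y ∘ u' = pt e, is_cokernel u' q & w = q ∘ u].

Let family_nonempty : exists k w, family (k := k) w.
Proof.
have [e Ge] := Gm0.
have [l [u [u' [y [yu yu']]]]] := fp_join lfpA isoG (fun _ : unit => x)
  (fun=> pt e) (fpG k0) (fpG (tag e)).
have [k [q qc]] := fp_cokernel_small lfpA isoG u' (fpG (tag e)) (fpG l).
by exists k, (q ∘ u), e, l, u, u', (y tt), q; split.
Qed.

(** Constraints on [x] over [e0] and [e1] get a common refinement over [e3]: join the three points,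
    then force the three identities by successive coequalizers. *)
Let amalgamate l0 l1 (u0 : hom (G k0) (G l0)) (u1 : hom (G k0) (G l1)) y0 y1
    e0 e1 e3 (u0' : hom (src e0) (G l0)) (u1' : hom (src e1) (G l1))
    (v0 : hom (src e0) (src e3)) (v1 : hom (src e1) (src e3)) :
  y0 ∘ u0 = x -> y1 ∘ u1 = x -> y0 ∘ u0' = pt e0 -> y1 ∘ u1' = pt e1 ->
  pt e3 ∘ v0 = pt e0 -> pt e3 ∘ v1 = pt e1 ->
  exists l (t0 : hom (G l0) (G l)) (t1 : hom (G l1) (G l)) (t : hom (src e3) (G l))
    (y : hom (G l) L), [/\ y ∘ t0 = y0, y ∘ t1 = y1, y ∘ t = pt e3,
    t0 ∘ u0 = t1 ∘ u1 & t0 ∘ u0' = t ∘ v0 /\ t1 ∘ u1' = t ∘ v1].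
Proof.
move=> yu0 yu1 yu0' yu1' ev0 ev1.
have [la [a0 [a1 [ya [ya0 ya1]]]]] := fp_join lfpA isoG (fun _ : unit => y0)
  (fun=> y1) (fpG l0) (fpG l1).
have [lb [b2 [b3 [yb [yb2 yb3]]]]] := fp_join lfpA isoG ya
  (fun=> pt e3) (fpG la) (fpG (tag e3)).
have [|l2 [c1 [z1 [zc1 c1E]]]] := fp_coequalize lfpA isoG
    (f := b2 ∘ a0 ∘ u0) (g := b2 ∘ a1 ∘ u1) (y := yb) (fpG k0) (fpG lb).
  by move=> s; rewrite !compA yb2 ya0 ya1 yu0.
have [|l3 [c2 [z2 [zc2 c2E]]]] := fp_coequalize lfpA isoG
    (f := c1 ∘ b2 ∘ a0 ∘ u0') (g := c1 ∘ b3 ∘ v0) (y := z1)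
    (fpG (tag e0)) (fpG l2).
  by move=> s; rewrite !compA zc1 yb2 yb3 ya0 yu0' ev0.
have [|l [c3 [z3 [zc3 c3E]]]] := fp_coequalize lfpA isoG
    (f := c2 ∘ c1 ∘ b2 ∘ a1 ∘ u1') (g := c2 ∘ c1 ∘ b3 ∘ v1) (y := z2)
    (fpG (tag e1)) (fpG l3).
  by move=> s; rewrite !compA zc2 zc1 yb2 yb3 ya1 yu1' ev1.
exists l, (c3 ∘ c2 ∘ c1 ∘ b2 ∘ a0), (c3 ∘ c2 ∘ c1 ∘ b2 ∘ a1),
  (c3 ∘ c2 ∘ c1 ∘ b3), (z3 tt).
split; last split.
- by rewrite !compA zc3 zc2 zc1 yb2 ya0.
- by rewrite !compA zc3 zc2 zc1 yb2 ya1.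
- by rewrite !compA zc3 zc2 zc1 yb3.
- by move: c1E => /(congr1 (fun z => c3 ∘ c2 ∘ z)); rewrite !compA.
- by move: c2E => /(congr1 (fun z => c3 ∘ z)); rewrite !compA.
- by move: c3E; rewrite !compA.
Qed.

(* The admissible values at [x] form a directed family of cosets of definable  *)
(* subgroups; by the chain condition a minimal one is contained in all others. *)
Lemma exists_extension_value : exists n : hom (G k0) N,
  forall e l (u : hom (G k0) (G l)) (u' : hom (src e) (G l)) (y : hom (G l) L),
  Gm e -> y ∘ u = x -> y ∘ u' = pt e ->
  exists h : hom (G l) N, h ∘ u = n /\ h ∘ u' = im e.
Proof.
have [kz [w0 [[e0 [l0 [u0 [u0' [y0 [q0 [Ge0 yu0 yu0' q0c w0E]]]]]]] w0min]]] :=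
  definable_dcc_min (@dccN k0) family_nonempty.
have [Gm_tame Gm_dir] := Gm_ok.
have [h0 h0E] := Gm_tame e0 Ge0 l0 u0' y0 yu0'.
exists (h0 ∘ u0) => e1 l1 u1 u1' y1 Ge1 yu1 yu1'.
have [e3 [Ge3 [v0 [pv0 iv0]] [v1 [pv1 iv1]]]] := Gm_dir _ _ Ge0 Ge1.
have [l [t0 [t1 [t [y [yt0 yt1 yt tu [tu0 tu1]]]]]]] :=
  amalgamate yu0 yu1 yu0' yu1' pv0 pv1.
have [k3 [q3 q3c]] := fp_cokernel_small lfpA isoG t (fpG (tag e3)) (fpG l).
have [tau [tauE _]] : exists! tau, tau ∘ q0 = q3 ∘ t0.
  by apply: q0c.2; rewrite -compA tu0 compA q3c.1 comp0l.
(* The refined constraint belongs to the family, so by minimality it allows every difference allowed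
   by [w0]. *)
have w0sub : forall z : hom (G k0) N, factors w0 z -> factors (tau ∘ w0) z.
  apply: w0min; exists e3, l, (t0 ∘ u0), t, y, q3; split=> //.
    by rewrite compA yt0.
  by rewrite w0E !compA tauE.
have [h3 h3E] := Gm_tame e3 Ge3 l t y yt.
have [d [dE _]] : exists! d, d ∘ q0 = h3 ∘ t0 - h0.
  by apply: q0c.2; rewrite compBl -compA tu0 compA h3E iv0 h0E subrr.
have [|z zE] := w0sub (d ∘ w0); first by exists d.
have diff : h3 ∘ t0 ∘ u0 - h0 ∘ u0 = z ∘ q3 ∘ t0 ∘ u0.
  by rewrite -compBl -dE -compA -w0E zE w0E !compA -(compA z) tauE !compA.
(* The correction [z ∘ q3] vanishes along [t]: it keeps the values on [e3] and moves the value at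
   [x] to the chosen one. *)
exists ((h3 - z ∘ q3) ∘ t1); split.
  by rewrite -compA -tu compA !compBl -diff opprB addrC subrK.
rewrite -compA tu1 compA compBl h3E -compA q3c.1 comp0r subr0.
exact: iv1.
Qed.

(** Each old point is joined with [x] in a direct sum, with value [n] on [x];
    [exists_extension_value] says that these joins are tame. *)
Lemma extend_directed_tame : exists Gm', [/\ directed_tame Gm', Gm `<=` Gm'
  & exists e (u : hom (G k0) (src e)), Gm' e /\ pt e ∘ u = x].
Proof.
have [n nE] := exists_extension_value.
pose new e e' := exists (i : hom (G k0) (src e')) (i' : hom (src e) (src e')),
  is_sum i i' /\ [/\ pt e' ∘ i = x, pt e' ∘ i' = pt e, im e' ∘ i = n
    & im e' ∘ i' = im e].
have exists_new e : exists e', new e e'.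
  have [k [i [i' ii']]] := fp_sum lfpA isoG (fpG k0) (fpG (tag e)).
  have [y [yi yi']] := ii'.1 _ x (pt e); have [m [mi mi']] := ii'.1 _ n (im e).
  by exists (Elt y m), i, i'.
have [Gm_tame Gm_dir] := Gm_ok.
pose Gm' := Gm `|` [set e' | exists2 e, Gm e & new e e'].
have below e : Gm' e -> exists2 es, Gm es &
    forall e3 e', le es e3 -> new e3 e' -> le e e'.
  move=> [Ge|[e1 Ge1 [i [i' [ii' [ei ei' ni ni']]]]]].
    exists e => // e3 e' ee3 [i [i' [_ [_ ei' _ ni']]]].
    by apply: le_trans ee3 _; exists i'.
  exists e1 => // e3 e' [u [pu iu]] [j [j' [jj' [ej ej' nj nj']]]].
  have [h [hi hi']] := ii'.1 _ j (j' ∘ u).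
  exists h; split; apply: ii'.2.
  - by rewrite -compA hi ej.
  - by rewrite -compA hi' compA ej' pu.
  - by rewrite -compA hi nj.
  - by rewrite -compA hi' compA nj' iu.
exists Gm'; split; last first.
- have [e Ge] := Gm0; have [e' ee'] := exists_new e.
  have [i [i' [_ [ei _ _ _]]]] := ee'; exists e', i; split=> //.
  by right; exists e.
- by left.
split=> [e [/Gm_tame//|[e1 Ge1 [i [i' [ii' [ei ei' ni ni']]]]]] l u y yu|e e'].
  have [||h [hu hu']] := nE e1 l (u ∘ i) (u ∘ i') y Ge1.
  - by rewrite compA yu.
  - by rewrite compA yu.
  by exists h; apply: ii'.2; rewrite -compA ?hu ?hu'.
move=> /below[es Ges esP] /below[es' Ges' esP'].
have [e3 [Ge3 ee3 ee3']] := Gm_dir _ _ Ges Ges'.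
have [e4 e34] := exists_new e3; exists e4; split; [|exact: esP e34|exact: esP' e34].
by right; exists e3.
Qed.

End Extension.

Lemma exists_total_directed_tame : exists Gm, [/\ directed_tame Gm, base `<=` Gm
  & forall k (x : hom (G k) L), exists e (u : hom (G k) (src e)),
    Gm e /\ pt e ∘ u = x].
Proof.
have [base_tame base_dir] := base_directed_tame.
(* Adjoining [base] inside the predicate makes it hold for the union of the empty chain. *)
have [F Fok Ftot|Gm [Gm_ok Gm_max]] :=
  @Zorn_bigcup elt (fun Gm => directed_tame (Gm `|` base)).
  split=> [e [[Gm FGm Ge]|/base_tame//]|].
    by apply: (Fok _ FGm).1; left.
  have up e : ((\bigcup_(Gm in F) Gm) `|` base) e ->
      base e \/ exists2 Gm, F Gm & Gm e.
    by move=> [[Gm FGm Ge]|be]; [right; exists Gm|left].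
  have inF Gm : F Gm -> forall e e', (Gm `|` base) e -> (Gm `|` base) e' ->
      exists e3, [/\ ((\bigcup_(Gm in F) Gm) `|` base) e3, le e e3 & le e' e3].
    move=> FGm e e' Ge Ge'; have [e3 [Ge3 ? ?]] := (Fok _ FGm).2 e e' Ge Ge'.
    exists e3; split=> //; case: Ge3 => [Ge3|]; last by right.
    by left; exists Gm.
  move=> e e' /up[be|[Gm FGm Ge]] /up[be'|[Gm' FGm' Ge']].
  - by have [e3 [b3 ? ?]] := base_dir e e' be be'; exists e3; split=> //; right.
  - by apply: (inF Gm') => //; [right|left].
  - by apply: (inF Gm) => //; [left|right].
  - have [sub|sub] := Ftot _ _ FGm FGm'.
      by apply: (inF Gm') => //; left => //; exact: sub.
    by apply: (inF Gm) => //; left => //; exact: sub.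
exists (Gm `|` base); split=> [//|e|k x]; first by right.
have Gm0 : (Gm `|` base) !=set0.
  by exists (Elt (0 : hom (G k) L) 0); right; exists 0; rewrite !comp0r.
have [Gm' [Gm'_ok sub [e [u [Ge eu]]]]] := extend_directed_tame x Gm_ok Gm0.
exists e, u; split=> //; left; apply: contrapT => nGe.
apply: (Gm_max Gm').
  by split=> [e' Ge'|/(_ e Ge)//]; apply: sub; left.
by have /setUidPl -> : base `<=` Gm' by move=> e' be'; apply: sub; right.
Qed.

Lemma pure_extension : exists g : hom L N, g ∘ a = f.
Proof.
have [Gm [[Gm_tame Gm_dir] base_sub Gm_total]] := exists_total_directed_tame.
pose R X (x : hom X L) (m : hom X N) := exists e (u : hom X (src e)),
  [/\ Gm e, pt e ∘ u = x & im e ∘ u = m].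
have [X x fpX|X Y v y n m fpX fpY|g gE] := @fp_dense A lfpA L N R.
- have [k [i [j [ji _]]]] := isoG fpX.
  have [e [u [Ge eu]]] := Gm_total k (x ∘ j).
  exists (im e ∘ (u ∘ i)), e, (u ∘ i); split=> //.
  by rewrite compA eu -compA ji compm1.
(* Two representations are compared above both, at [e3]; a coequalizer turns equality of points into
   a condition that tameness transfers to the values. *)
- move=> [e [u [Ge eu <-]]] [e' [u' [Ge' eu' <-]]].
  have [e3 [Ge3 [w [pw iw]] [w' [pw' iw']]]] := Gm_dir _ _ Ge Ge'.
  have [|k [q [z [zq qE]]]] := fp_coequalize lfpA isoG (f := w' ∘ u')
      (g := w ∘ u ∘ v) (y := fun _ : unit => pt e3) fpX (fpG (tag e3)).
    by move=> _; rewrite !compA pw' pw eu' eu.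
  have [h hq] := Gm_tame e3 Ge3 k q (z tt) (zq tt).
  by rewrite -iw -iw' -hq -!compA; congr (_ ∘ _); rewrite qE !compA.
exists g; apply: (fp_jointly_epi lfpA) => X x fpX.
rewrite -compA; apply: gE => //.
have [k [i [j [ji _]]]] := isoG fpX.
exists (Elt (a ∘ (x ∘ j)) (f ∘ (x ∘ j))), i; split.
- by apply: base_sub; exists (x ∘ j).
- by rewrite /pt /= -!compA ji compm1.
- by rewrite /im /= -!compA ji compm1.
Qed.

End DccPureInjective.

Theorem theorem3p6 (A : preadditive_category) (M : A) :
  locally_finitely_presented A ->
  (forall X : A, finitely_presented X -> ~ omega_measurable (hom X M)) ->
  ((forall N : A, Add M N -> Prod M N) <-> Sigma_pure_injective M).
Proof.
move=> lfpA nmeas; split=> [AddProd J S i i_coprod K L a [C [b ab]] f|].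
  have [_ _ [J0 [G [fpG isoG]]] _] := lfpA.
  apply: (pure_extension lfpA fpG isoG f ab) => k.
  apply: (definable_dcc_coproduct lfpA i_coprod (fpG k)).
  exact: Add_Prod_definable_dcc (nmeas _ (fpG k)) AddProd.
exact: Sigma_pure_injective_Add_Prod.
Qed.
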